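(* Let $\mathcal A$ be a van Hove sequence in $G$ and let $\mu,\nu\in\mathcal{M}^\infty(G)$ be such that the Eberlein convolution $\mu\circledast_{\mathcal A}\nu$ is well defined. (a) If $\mu$ is mean almost periodic with respect to $\mathcal A$, then $\mu\circledast_{\mathcal A}\nu$ is a strongly almost periodic measure. (b) If $\nu$ is mean almost periodic with respect to $-\mathcal A$, then $\mu\circledast_{\mathcal A}\nu$ is a strongly almost periodic measure.
   Context: $G$ is a second countable, locally compact (Hausdorff) Abelian group with Haar measure $|\cdot|$. A van Hove sequence is a sequence $\mathcal A=(A_n)_{n\in\mathbb N}$ of precompact open subsets of $G$ (of positive measure) such that $\lim_{n}|\partial^K A_n|/|A_n|=0$ for each compact $K\subseteq G$, where for open $A$, $\partial^K A:=(\overline{A+K}\setminus A)\cup(((G\setminus A)-K)\cap\overline A)$. Write $-\mathcal A=(-A_n)_{n\in\mathbb N}$. A measure on $G$ is a complex Radon measure, viewed as a linear functional on $C_c(G)$; $|\mu|$ denotes its variation measure. $\mathcal M^\infty(G)$ is the set of translation bounded measures, i.e. those with $\sup_{t\in G}|\mu|(t+K)<\infty$ for every compact $K$. For $\varphi\in C_c(G)$, $(\mu*\varphi)(t)=\int_G\varphi(t-s)\,d\mu(s)$. The Eberlein convolution is $\mu\circledast_{\mathcal A}\nu:=\lim_{n\to\infty}\frac1{|A_n|}(\mu|_{A_n})*(\nu|_{-A_n})$, well defined if this limit exists in the vague topology. $C_u(G)$ is the space of bounded uniformly continuous functions $G\to\mathbb C$; $(\tau_tf)(x)=f(x-t)$.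 A function $f\in C_u(G)$ is strongly almost periodic if the closure of $\{\tau_tf:t\in G\}$ in $(C_u(G),\|\cdot\|_\infty)$ is compact; a measure $\mu$ is strongly almost periodic if $\mu*\varphi$ is a strongly almost periodic function for all $\varphi\in C_c(G)$. For a van Hove sequence $\mathcal A$ and $f\in L^1_{\mathrm{loc}}(G)$ let $\|f\|_{b,1,\mathcal A}:=\limsup_{n}\frac1{|A_n|}\int_{A_n}|f(t)|\,dt$; let $BL^1_{\mathcal A}(G)$ be the space of $f$ with $\|f\|_{b,1,\mathcal A}<\infty$ and $BC^1_{\mathcal A}(G)$ the closure of $C_u(G)$ in it. $\mathrm{MAP}_{\mathcal A}(G)$ is the set of $f\in C_u(G)$ such that for each $\varepsilon>0$ the set $\{t\in G:\|f-\tau_tf\|_{b,1,\mathcal A}<\varepsilon\}$ is relatively dense, and $\mathrm{Map}^1_{\mathcal A}(G)$ is the closure of $\mathrm{MAP}_{\mathcal A}(G)$ in $BC^1_{\mathcal A}(G)$ with respect to $\|\cdot\|_{b,1,\mathcal A}$. A measure $\mu$ is mean almost periodic with respect to $\mathcal A$ if $\mu*\varphi\in\mathrm{Map}^1_{\mathcal A}(G)$ for all $\varphi\in C_c(G)$. *)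

(* Defs.v *)
From HB Require Import structures.
From mathcomp Require Import all_boot all_order all_algebra.
From mathcomp Require Import all_classical all_reals all_analysis.
From mathcomp.real_closed Require Import complex.

Set Implicit Arguments.
Unset Strict Implicit.
Unset Printing Implicit Defensive.

Import Order.TTheory GRing.Theory Num.Theory.
Import numFieldNormedType.Exports.

Local Open Scope classical_set_scope.
Local Open Scope ring_scope.

#[warnings="-redundant-canonical-projection"]
HB.instance Definition _ (R : realType) := PseudoPointedMetric.copy R[i] R[i]^o.
#[warnings="-redundant-canonical-projection"]
HB.instance Definition _ (R : realType) := NormedModule.copy R[i] R[i]^o.

(* [`|z|] lives in R[i]; [cmod z] is the same number as an element of R. *)
Definition cmod (R : realType) (z : R[i]) : R := complex.Re `|z|.

(* measurableType requires a pointed carrier, which topologicalZmodType does not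
   provide. *)
Definition zero_pointed (G : topologicalZmodType) : Type := G.
HB.instance Definition _ (G : topologicalZmodType) :=
  Choice.on (zero_pointed G).
HB.instance Definition _ (G : topologicalZmodType) :=
  isPointed.Build (zero_pointed G) (0 : G).

Notation borel G :=
  (g_sigma_algebraType (@open G : set (set (zero_pointed G)))).

Section sets_and_functions.
Variable (G : topologicalZmodType).

Definition oppset (A : set G) : set G := [set - x | x in A].

Definition sumset (A B : set G) : set G := [set x + y | x in A & y in B].

Definition vH_boundary (K A : set G) : set G :=
  (closure (sumset A K) `\` A) `|` (sumset (~` A) (oppset K) `&` closure A).

Definition relatively_dense (P : set G) : Prop :=
  exists2 K : set G, compact K & sumset P K = setT.

Variable (R : realType).
Implicit Types (f phi : G -> R[i]).

Definition translate (t : G) f : G -> R[i] := fun x => f (x - t).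

Definition Cc phi : Prop :=
  continuous phi /\ compact (closure [set x | phi x != 0]).

(* Uniform continuity for the uniform structure of the topological group. *)
Definition Cu f : Prop :=
  (exists M : R, forall x, cmod (f x) <= M) /\
  (forall e : R, 0 < e -> exists2 U : set G, nbhs 0 U &
     forall x y, U (x - y) -> cmod (f x - f y) < e).

Definition strongly_ap_fun f : Prop :=
  Cu f /\
  compact ([set g | Cu g] `&`
    closure ([set translate t f | t in [set: G]] : set {uniform G -> R[i]})
    : set {uniform G -> R[i]}).

End sets_and_functions.

Section measures.
Variables (G : topologicalZmodType) (R : realType).
Implicit Types (m : {measure set (borel G) -> \bar R}).

Definition radon m : Prop :=
  [/\ forall K : set G, compact K -> (m K < +oo)%E,
      forall B : set (borel G), measurable B ->
        m B = ereal_inf [set m U | U in [set U : set G | open U /\ B `<=` U]]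
    & forall U : set G, open U ->
        m U = ereal_sup [set m K | K in [set K : set G | compact K /\ K `<=` U]]].

Definition is_haar m : Prop :=
  [/\ radon m, m setT != 0%E
    & forall (t : G) (B : set (borel G)), measurable B ->
        m [set t + x | x in (B : set G)] = m B].

Definition cintegral m (D : set G) (f : G -> R[i]) : R[i] :=
  ((\int[m]_(x in D) complex.Re (f x))%R
    +i* (\int[m]_(x in D) complex.Im (f x))%R)%C.

(* A complex Radon measure (re_pos - re_neg) + i (im_pos - im_neg), not
   necessarily of finite total mass, so that it has no value on sets that are
   not precompact. The four parts need not be mutually singular; everything
   below depends only on the measure they define together. *)
Record complex_radon := ComplexRadon {
  re_pos : {measure set (borel G) -> \bar R};
  re_neg : {measure set (borel G) -> \bar R};
  im_pos : {measure set (borel G) -> \bar R};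
  im_neg : {measure set (borel G) -> \bar R};
  re_pos_radon : radon re_pos;
  re_neg_radon : radon re_neg;
  im_pos_radon : radon im_pos;
  im_neg_radon : radon im_neg }.

Implicit Types (mu nu : complex_radon).

(* Integral of f against the restriction of mu to D. *)
Definition mintegral mu (D : set G) (f : G -> R[i]) : R[i] :=
  (cintegral (re_pos mu) D f - cintegral (re_neg mu) D f)
  + 'i%C * (cintegral (im_pos mu) D f - cintegral (im_neg mu) D f).

Definition functional mu (phi : G -> R[i]) : R[i] := mintegral mu setT phi.

(* Meaningful for precompact Borel sets only. *)
Definition mass mu (B : set G) : R[i] :=
  ((fine (re_pos mu B) - fine (re_neg mu B))%R
    +i* (fine (im_pos mu B) - fine (im_neg mu B))%R)%C.

Definition variation_measure mu (B : set G) : \bar R :=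
  ereal_sup [set s | exists n (F : nat -> set G),
    [/\ forall k, (k < n)%N ->
          [/\ measurable (F k : set (borel G)), precompact (F k) & F k `<=` B],
        trivIset `I_n F
      & s = (\sum_(k < n) cmod (mass mu (F k)))%:E]].

Definition translation_bounded mu : Prop :=
  forall K : set G, compact K -> exists C : R, forall t : G,
    (variation_measure mu [set (t + x)%R | x in K] <= C%:E)%E.

Definition convolution mu (phi : G -> R[i]) : G -> R[i] :=
  fun t => functional mu (fun s => phi (t - s)).

(* phi |-> ((mu|_D) * (nu|_E))(phi) *)
Definition restr_convolution mu (D : set G) nu (E : set G) (phi : G -> R[i]) :
    R[i] :=
  mintegral mu D (fun s => mintegral nu E (fun t => phi (s + t))).

Definition vague_cvg (u : nat -> (G -> R[i]) -> R[i]) (lambda : complex_radon) :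
    Prop :=
  forall phi, Cc phi -> u n phi @[n --> \oo] --> functional lambda phi.

Definition strongly_ap mu : Prop :=
  forall phi, Cc phi -> strongly_ap_fun (convolution mu phi).

Variable haar : {measure set (borel G) -> \bar R}.

Definition van_hove (A : nat -> set G) : Prop :=
  (forall n, [/\ open (A n), precompact (A n) & (0 < haar (A n))%E]) /\
  (forall K : set G, compact K ->
     fine (haar (vH_boundary K (A n))) / fine (haar (A n)) @[n --> \oo]
       --> (0 : R)).

Section mean.
Variable A : nat -> set G.
Implicit Types f : G -> R[i].

Definition L1loc f : Prop :=
  forall K : set G, compact K ->
    haar.-integrable K (fun x => (complex.Re (f x))%:E) /\
    haar.-integrable K (fun x => (complex.Im (f x))%:E).

Definition bnorm f : \bar R :=
  limn_esup (fun n => (((fine (haar (A n)))^-1)%:E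
    * \int[haar]_(t in A n) (cmod (f t))%:E)%E).

Definition BL1 f : Prop := L1loc f /\ (bnorm f < +oo)%E.

Definition BC1 f : Prop :=
  BL1 f /\ forall e : R, 0 < e ->
    exists2 g : G -> R[i], Cu g & (bnorm (f \- g)%R < e%:E)%E.

Definition MAP f : Prop :=
  Cu f /\ forall e : R, 0 < e ->
    relatively_dense [set t | (bnorm (f \- translate t f)%R < e%:E)%E].

Definition Map1 f : Prop :=
  BC1 f /\ forall e : R, 0 < e ->
    exists2 g : G -> R[i], MAP g & (bnorm (f \- g)%R < e%:E)%E.

Definition mean_ap mu : Prop :=
  forall phi, Cc phi -> Map1 (convolution mu phi).

End mean.

(* lambda is the Eberlein convolution of mu and nu along A; the Eberlein
   convolution is well defined when such a lambda exists. *)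
Definition is_eberlein (A : nat -> set G) mu nu (lambda : complex_radon) : Prop :=
  vague_cvg (fun n phi => ((fine (haar (A n)))^-1)%:C%C
    * restr_convolution mu (A n) nu (oppset (A n)) phi) lambda.

End measures.

(* Main.v *)
(* Let [f = mu * phi]. Up to a boundary term, [(lambda * phi)(t)] is the limit of
   the normalized integrals of [f (t - u)] against [nu] over [- A n]. If [r] is an
   almost period of [f] in mean, then [h = f - tau_r f] is uniformly continuous
   and small in mean with respect to Haar measure. A maximal packing of [A n] by
   translates of a small neighbourhood [V] cuts [A n] into cells on which [h] is
   controlled by its Haar average over disjoint translates of [V]; so [h] is also
   small in mean with respect to [nu], uniformly in [t]. Hence the almost periods
   of [f] in mean are uniform almost periods of [lambda * phi], and Bohr's
   criterion gives compactness of the closure of its orbit.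
   For (b) exchange [mu] and [nu] and replace [A n] by [- A n]: packing shows that
   the reflected sequence satisfies the same estimates and that the Haar measures
   of [A n] and [- A n] are comparable. *)
Require Import Defs.
From mathcomp Require Import all_boot all_order all_algebra.
From mathcomp Require Import all_classical all_reals all_analysis.
From mathcomp Require Import measurable_realfun.
From mathcomp.real_closed Require Import complex.
From mathcomp Require Import ring lra.

Set Implicit Arguments.
Unset Strict Implicit.
Unset Printing Implicit Defensive.

Import Order.TTheory GRing.Theory Num.Theory.
Import numFieldNormedType.Exports.

Local Open Scope classical_set_scope.
Local Open Scope ring_scope.

(** Smallness in mean for Haar measure by itself says nothing about [nu], which may be singular to
    it. The bridging estimate [mean_bound] therefore carries two constants: the one in front of the
    oscillation is independent of the scale [V] of the packing, the one in front of the Haar mean is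
    not. This dictates the order of choices: a tolerance for the oscillation, then [V], and only
    then the quality of the almost periods. The truncated convolution is an iterated integral with
    [mu] outside, which suits (b); (a) needs [nu] outside, and the exchange is proved by Riemann
    sums. The normalizing factor is separated from the averaging sequence, because in (b) the
    averages run over [- A n] but are still divided by the volume of [A n]. *)

Section cmod.
Variable R : realType.
Implicit Types z w : R[i].

Lemma normcE_cmod z : `|z| = (cmod z)%:C%C.
Proof. by rewrite /cmod normc_def. Qed.

Lemma cmod_ge0 z : 0 <= cmod z.
Proof. by rewrite -ler0c -normcE_cmod normr_ge0. Qed.

Lemma cmod0 : cmod (0 : R[i]) = 0.
Proof. by rewrite /cmod normr0. Qed.

Lemma cmodN z : cmod (- z) = cmod z.
Proof. by rewrite /cmod normrN. Qed.

Lemma cmodM z w : cmod (z * w) = cmod z * cmod w.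
Proof. by apply: complexI; rewrite -normcE_cmod normrM !normcE_cmod rmorphM. Qed.

Lemma cmodD z w : cmod (z + w) <= cmod z + cmod w.
Proof. by rewrite -lecR rmorphD -!normcE_cmod ler_normD. Qed.

Lemma cmodB z w : cmod (z - w) = cmod (w - z).
Proof. by rewrite -cmodN opprB. Qed.

Lemma cmod_real (r : R) : cmod (r%:C)%C = `|r|.
Proof. by rewrite /cmod normc_def /= expr0n addr0 sqrtr_sqr. Qed.

Lemma cmod_sum I (s : seq I) (P : pred I) (F : I -> R[i]) :
  cmod (\sum_(i <- s | P i) F i) <= \sum_(i <- s | P i) cmod (F i).
Proof.
elim/big_ind2 : _ => [|x y z w xy zw|//]; first by rewrite cmod0.
by rewrite (le_trans (cmodD _ _))// lerD.
Qed.

Lemma cmod_lerB z w : cmod z <= cmod w + cmod (z - w).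
Proof. by rewrite (le_trans _ (cmodD _ _))// addrC subrK. Qed.

Lemma cmod_dist z w : `|cmod z - cmod w| <= cmod (z - w).
Proof.
have h1 := cmod_lerB z w; have := cmod_lerB w z; rewrite (cmodB w z) => h2.
by rewrite ler_norml; apply/andP; split; lra.
Qed.

Lemma Re_le_cmod z : `|complex.Re z| <= cmod z.
Proof. by rewrite -lecR -normcE_cmod normc_ge_Re. Qed.

Lemma cmod_i : cmod ('i%C : R[i]) = 1.
Proof. by rewrite /cmod normc_def /= expr0n expr1n add0r sqrtr1. Qed.

Lemma Im_le_cmod z : `|complex.Im z| <= cmod z.
Proof.
have := Re_le_cmod (z * 'i%C).
by rewrite ReiNIm normrN cmodM cmod_i mulr1.
Qed.

Lemma cmod_le_ReIm z : cmod z <= `|complex.Re z| + `|complex.Im z|.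
Proof.
rewrite {1}[z]complexE (le_trans (cmodD _ _))//.
by rewrite cmodM cmod_i mul1r !cmod_real.
Qed.

(** A positive radius in [R[i]] has zero imaginary part, so complex radii for the norm and real
    radii for [cmod] describe the same neighbourhoods. *)
Lemma cvg_cmodP T (F : set_system T) {FF : Filter F} (u : T -> R[i]) l :
  u @ F --> l <-> forall e : R, 0 < e -> \forall x \near F, cmod (l - u x) < e.
Proof.
split=> [ul e e0|ul].
  move/(@cvgrPdist_lt _ _ _ _ _ u l) in ul.
  have := ul (e%:C)%C; rewrite ltcR => /(_ e0).
  by apply: filterS => x; rewrite normcE_cmod ltcR.
apply/(@cvgrPdist_lt _ _ _ _ _ u l) => e; rewrite ltcE/= => /andP[/eqP ime e0].
have := ul _ e0; apply: filterS => x.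
by rewrite normcE_cmod ltcE/= ime eqxx.
Qed.

(** The disc lies in the image of a compact square. It supplies the pointwise cluster values in
    [bohr_strongly_ap]. *)
Lemma compact_disc (M : R) : exists2 K : set R[i],
  compact K & forall z, cmod z <= M -> K z.
Proof.
pose f (x : R * R) := Complex x.1 x.2.
exists (f @` (`[- M, M]%classic `*` `[- M, M]%classic)).
  apply: continuous_compact; last first.
    by apply: compact_setX; exact: segment_compact.
  apply/continuous_subspaceT => x; apply/cvg_cmodP => e e0.
  have e20 : 0 < e / 2 by rewrite divr_gt0.
  have h1 : \forall y \near x, `|x.1 - y.1| < e / 2.
    have h : (y.1 @[y --> x] --> x.1) by exact: cvg_fst.
    exact: cvgr_dist_lt h _ e20.
  have h2 : \forall y \near x, `|x.2 - y.2| < e / 2.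
    have h : (y.2 @[y --> x] --> x.2) by exact: cvg_snd.
    exact: cvgr_dist_lt h _ e20.
  near=> y; rewrite (le_lt_trans (cmod_le_ReIm _))//= [ltRHS]splitr.
  by rewrite ltrD//; near: y.
move=> z zM; exists (complex.Re z, complex.Im z); last by case: z {zM}.
have ReM := le_trans (Re_le_cmod z) zM.
have ImM := le_trans (Im_le_cmod z) zM.
by split; rewrite /= in_itv/= -ler_norml.
Unshelve. all: by end_near. Qed.

End cmod.

(** * Boundaries in topological groups *)

Section topological_group.
Variable G : topologicalZmodType.
Implicit Types (A B K L U V : set G) (x y t : G).

Lemma continuous_addl t : continuous (fun x => t + x).
Proof.
move=> x; apply: (@continuous_comp G (G * G)%type G (fun x => (t, x))
  (fun z : G * G => z.1 + z.2)); last exact: add_continuous.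
by apply: cvg_pair => /=; [exact: cvg_cst|exact: cvg_id].
Qed.

Lemma continuous_addr t : continuous (fun x => x + t).
Proof.
move=> x; apply: (@continuous_comp G (G * G)%type G (fun x => (x, t))
  (fun z : G * G => z.1 + z.2)); last exact: add_continuous.
by apply: cvg_pair => /=; [exact: cvg_id|exact: cvg_cst].
Qed.

Lemma nbhs_subr x U : nbhs (0 : G) U -> nbhs x [set y | U (y - x)].
Proof. by move=> U0; apply: (@continuous_addr (- x) x); rewrite subrr. Qed.

Lemma nbhs0_opp U : nbhs (0 : G) U -> nbhs (0 : G) [set x : G | U (- x)].
Proof. by move=> U0; apply: (@opp_continuous G 0); rewrite oppr0. Qed.

Lemma open_addl t U : open U -> open [set x | U (t + x)].
Proof. by move=> oU; apply: open_comp => // x _; exact: continuous_addl. Qed.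

Lemma open_opp U : open U -> open [set x : G | U (- x)].
Proof. by move=> oU; apply: open_comp => // x _; exact: opp_continuous. Qed.

Lemma closed_opp U : closed U -> closed [set x : G | U (- x)].
Proof. by move=> cU; apply: closed_comp => // x _; exact: opp_continuous. Qed.

Lemma nbhs0_half U : nbhs (0 : G) U -> exists2 V, nbhs (0 : G) V &
  forall a b, V a -> V b -> U (a + b).
Proof.
move=> U0; have : nbhs ((0 : G), (0 : G)) [set z : G * G | U (z.1 + z.2)].
  by apply: (@add_continuous G (0, 0)); rewrite /= addr0.
case=> -[V W] /= [V0 W0] VW; exists (V `&` W); first exact: filterI.
by move=> a b [Va _] [_ Wb]; apply: (VW (a, b)).
Qed.

(** Two halvings allow four summands, as many as occur in a difference of two points of [V - V].
    Intersecting with a closed compact neighbourhood and then with the reflection gives compact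
    closure and symmetry. *)
Lemma small_nbhs (lcG : locally_compact [set: G]) U : nbhs (0 : G) U -> exists V,
  [/\ open V, V 0, (forall x, V x -> V (- x)), compact (closure V) &
      forall a b c d, V a -> V b -> V c -> V d -> U ((a + b) + (c + d))].
Proof.
move=> U0; have [U1 U10 U1U] := nbhs0_half U0.
have [U2 U20 U2U1] := nbhs0_half U10.
have [K K0 [cK clK]] : compact_near (within [set: G] (nbhs (0 : G))) by exact: (lcG 0 I).
have K0' : nbhs (0 : G) K.
  by move: K0; rewrite /within /=; apply: filterS => x; apply.
pose W := (U2 `&` K)°.
have W0 : nbhs (0 : G) W by apply/nbhs_interior/filterI.
have oW : open W by exact: open_interior.
have WU x : W x -> (U2 `&` K) x by exact: interior_subset.
exists (W `&` [set x | W (- x)]); split.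
- by apply: openI => //; exact: open_opp.
- by split; rewrite /= ?oppr0; exact: nbhs_singleton.
- by move=> x [Wx WNx]; split => //=; rewrite opprK.
- apply: (subclosed_compact _ cK); first exact: closed_closure.
  rewrite (closure_id K).1//; apply: closureS => x [/WU[]].
  by [].
- move=> a b c d [/WU[a2 _] _] [/WU[b2 _] _] [/WU[c2 _] _] [/WU[d2 _] _].
  by apply: U1U; exact: U2U1.
Qed.

Lemma compact_sumset K L : compact K -> compact L -> compact (sumset K L).
Proof.
move=> cK cL; have -> : sumset K L = (fun z => z.1 + z.2) @` (K `*` L).
  apply/seteqP; split=> [_ [x Kx [y Ly <-]]|_ [[x y] /= [Kx Ly] <-]].
    by exists (x, y).
  by exists x => //; exists y.
apply: continuous_compact; last exact: compact_setX.
by apply/continuous_subspaceT => x; exact: add_continuous.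
Qed.

Lemma oppsetE A : oppset A = [set x | A (- x)].
Proof.
apply/seteqP; split=> [_ [x Ax <-]|x Ax] /=; first by rewrite opprK.
by exists (- x) => //; rewrite opprK.
Qed.

Lemma oppsetK A : oppset (oppset A) = A.
Proof. by rewrite !oppsetE; apply/seteqP; split=> x; rewrite /= opprK. Qed.

Lemma compact_oppset K : compact K -> compact (oppset K).
Proof.
move=> cK; apply: continuous_compact => //.
by apply/continuous_subspaceT => x; exact: opp_continuous.
Qed.

(** The set is [A - K]. If [x] lies outside, each [l] in [K] has a neighbourhood that, with one of
    [x], keeps sums out of [A]; compactness of [K] merges these into a single neighbourhood of
    [x]. *)
Lemma closed_shift_compact K A : compact K -> closed A ->
  closed [set x | exists2 l, K l & A (x + l)].
Proof.
move=> cK cA; rewrite closedE => x /= hx.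
apply: contrapT => nx; apply: hx.
have : \forall x' \near x, K `<=` [set l | ~ A (x' + l)].
  move/compact_near_coveringP : cK; apply => l Kl.
  have nA : nbhs (x + l) (~` A).
    apply: open_nbhs_nbhs; split; first exact: closed_openC.
    by move=> Axl; apply: nx; exists l.
  have : nbhs (l, x) [set z : G * G | ~ A (z.2 + z.1)].
    have := (@add_continuous G (l, x) (~` A)); rewrite /= (addrC l x).
    by move=> /(_ nA) [W lxW WA]; exists W => // z /WA /=; rewrite addrC.
  by [].
apply: filterS => x' Kx' [l Kl Axl]; exact: (Kx' l Kl).
Qed.

Lemma open_shift L A : open A -> open [set x | exists2 l, L l & A (x + l)].
Proof.
move=> oA.
have -> : [set x | exists2 l, L l & A (x + l)] =
    \bigcup_(l in L) [set x | A (l + x)].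
  by apply/seteqP; split=> x [l Ll /= Ax]; exists l => //=; rewrite addrC.
by apply: bigcup_open => l _; exact: open_addl.
Qed.

(* Up to enlarging [L] this is the van Hove boundary, but it behaves well under
   translation and reflection of [A]. *)
Definition bdry L A : set G := [set x |
  (exists2 l, L l & A (x + l)) /\ (exists2 l, L l & ~ A (x + l))].

(** The two pieces of [vH_boundary] use [K] with opposite signs, hence the symmetrized set. *)
Lemma bdry_vH L A : bdry L A `<=` vH_boundary (L `|` oppset L) A.
Proof.
move=> x [[l Ll Al] [k Lk Ak]].
have [Ax|nAx] := pselect (A x).
  right; split; last exact: subset_closure.
  exists (x + k) => //; exists (- k); last by rewrite addrK.
  by exists k => //; left.
left; split => //; apply: subset_closure.
exists (x + l) => //; exists (- l); last by rewrite addrK.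
by right; exists l.
Qed.

(** A boundary thickened by [V] lies in the boundary for a larger compact set, so packings of a
    boundary are again counted by the volume of a boundary. *)
Lemma bdry_add L V A x v : bdry L A x -> V v ->
  bdry (sumset L (oppset V)) A (x + v).
Proof.
move=> [[l Ll Al] [k Lk Ak]] Vv.
split; [exists (l - v); last by rewrite addrACA subrr addr0|
  exists (k - v); last by rewrite addrACA subrr addr0].
- by exists l => //; exists (- v) => //; exists v.
- by exists k => //; exists (- v) => //; exists v.
Qed.

Lemma bdry_opp L A x : bdry L (oppset A) x -> bdry (oppset L) A (- x).
Proof.
rewrite !oppsetE => -[[l Ll Al] [k Lk Ak]].
split; [exists (- l)|exists (- k)]; rewrite /= ?opprK -?opprD//.
Qed.

Lemma sumset_bdry L A x l : L 0 -> L l -> A (x + l) -> A x \/ bdry L A x.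
Proof.
move=> L0 Ll Axl; have [Ax|nAx] := pselect (A x); [by left|right].
by split; [exists l|exists 0 => //; rewrite addr0].
Qed.

Lemma relatively_denseS (P Q : set G) : P `<=` Q ->
  relatively_dense P -> relatively_dense Q.
Proof.
move=> PQ [K cK PK]; exists K => //; apply/seteqP; split=> // x _.
have [p Pp [k Kk pkx]] : sumset P K x by rewrite PK.
by exists p; [exact: PQ|exists k].
Qed.

End topological_group.

(** * Uniformly continuous functions *)

Section Cu.
Variables (G : topologicalZmodType) (R : realType).
Implicit Types (f g phi : G -> R[i]).

(* [nbhs 0] in the definition of [Cu] is elaborated through a structure on which
   the filter instance of [nbhs] is not inferred. *)
Lemma CuP f : Cu f <-> (exists M : R, forall x, cmod (f x) <= M) /\
  (forall e : R, 0 < e -> exists2 U : set G, nbhs (0 : G) U &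
     forall x y, U (x - y) -> cmod (f x - f y) < e).
Proof. by []. Qed.

Lemma Cu_bound f : Cu f -> exists2 M : R, 0 <= M & forall x, cmod (f x) <= M.
Proof.
move=> [[M fM] _]; exists M => //.
exact: le_trans (cmod_ge0 _) (fM 0).
Qed.

Lemma Cu_cst (c : R[i]) : Cu (fun _ : G => c).
Proof.
split; first by exists (cmod c).
by move=> e e0; exists setT => [|x y _]; [exact: filterT|rewrite subrr cmod0].
Qed.

Lemma CuD f g : Cu f -> Cu g -> Cu (fun x => f x + g x).
Proof.
move=> /CuP[[M fM] fu] /CuP[[N gN] gu]; apply/CuP; split.
  by exists (M + N) => x; rewrite (le_trans (cmodD _ _))// lerD.
move=> e e0; have e20 : 0 < e / 2 by rewrite divr_gt0.
have [U U0 fU] := fu _ e20; have [V V0 gV] := gu _ e20.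
exists (U `&` V) => [|x y [Uxy Vxy]]; first exact: filterI.
rewrite opprD addrACA (le_lt_trans (cmodD _ _))// [ltRHS]splitr.
by rewrite ltrD ?fU ?gV.
Qed.

Lemma CuZ (c : R[i]) f : Cu f -> Cu (fun x => c * f x).
Proof.
move=> /CuP[[M fM] fu]; apply/CuP; split.
  by exists (cmod c * M) => x; rewrite cmodM ler_wpM2l ?cmod_ge0.
move=> e e0; have c0 : 0 < cmod c + 1 by rewrite ltr_wpDl ?cmod_ge0.
have [U U0 fU] := fu (e / (cmod c + 1)) (divr_gt0 e0 c0).
exists U => // x y Uxy; rewrite -mulrBr cmodM.
rewrite (@le_lt_trans _ _ ((cmod c + 1) * cmod (f x - f y)))//.
  by rewrite ler_wpM2r ?cmod_ge0// lerDl.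
by rewrite mulrC -ltr_pdivlMr// fU.
Qed.

Lemma CuB f g : Cu f -> Cu g -> Cu (fun x => f x - g x).
Proof.
move=> cf cg; have := CuD cf (CuZ (-1) cg).
by under [X in Cu X]funext do rewrite mulN1r.
Qed.

Lemma Cu_sum n (F : 'I_n -> G -> R[i]) : (forall i, Cu (F i)) ->
  Cu (fun x => \sum_(i < n) F i x).
Proof.
move=> FC; elim: n F FC => [F _|n IH F FC].
  by under [X in Cu X]funext do rewrite big_ord0; exact: Cu_cst.
under [X in Cu X]funext do rewrite big_ord_recr/=.
by apply: CuD => //; exact: IH.
Qed.

Lemma Cu_addl f t : Cu f -> Cu (fun x => f (t + x)).
Proof.
move=> /CuP[[M fM] fu]; apply/CuP; split; first by exists M.
move=> e /fu[U U0 fU]; exists U => // x y Uxy; apply: fU.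
by rewrite opprD addrACA subrr add0r.
Qed.

Lemma Cu_opp f : Cu f -> Cu (fun x => f (- x)).
Proof.
move=> /CuP[[M fM] fu]; apply/CuP; split; first by exists M.
move=> e /fu[U U0 fU]; exists [set x | U (- x)]; first exact: nbhs0_opp.
by move=> x y Uxy; apply: fU; rewrite -opprD.
Qed.

Lemma Cu_translate f t : Cu f -> Cu (translate t f).
Proof.
move=> /(Cu_addl (- t)); rewrite /translate.
by under [X in Cu X -> _]funext do rewrite addrC.
Qed.

Lemma Cu_flip f t : Cu f -> Cu (fun x => f (t - x)).
Proof. by move=> /(Cu_addl t)/Cu_opp. Qed.

Lemma Cc_bound phi : Cc phi -> exists M : R, forall x, cmod (phi x) <= M.
Proof.
move=> [cphi cK].
have : \forall M \near +oo, closure [set x | phi x != 0] `<=`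
    [set x | cmod (phi x) <= M].
  move/compact_near_coveringP : cK; apply => x _.
  have := cphi x => /cvg_cmodP /(_ 1 ltr01) h.
  exists ([set y | cmod (phi x - phi y) < 1], [set M | cmod (phi x) + 1 <= M]).
    by split=> //=; apply: nbhs_pinfty_ge; exact: num_real.
  move=> [y M] /= [xy]; apply: le_trans.
  by rewrite (le_trans (cmod_lerB _ (phi x)))// cmodB lerD2l ltW.
move=> [N [_ NM]]; exists (Num.max (N + 1) 0) => x.
have [->|x0] := eqVneq (phi x) 0; first by rewrite cmod0 le_max lexx orbT.
rewrite le_max; apply/orP; left; apply: NM; first by rewrite ltrDl.
exact: subset_closure.
Qed.

(** Compactness of the support gives one modulus for all base points in it, for shifts by [u] and by
    [- u]. Of two close points, either one lies in the support and serves as base, or both values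
    vanish. *)
Lemma Cc_Cu phi : Cc phi -> Cu phi.
Proof.
move=> cphi; apply/CuP; split; first exact: Cc_bound.
case: cphi => cphi cK e e0; have e20 : 0 < e / 2 by rewrite divr_gt0.
have : \forall u \near (0 : G), closure [set x | phi x != 0] `<=`
    [set x | cmod (phi (x + u) - phi x) < e].
  move/compact_near_coveringP : cK; apply => x _.
  have h1 : \forall y \near x, cmod (phi x - phi y) < e / 2.
    by have := cphi x => /cvg_cmodP /(_ _ e20).
  have h2 : \forall y \near (x, (0 : G)), cmod (phi x - phi (y.1 + y.2)) < e / 2.
    have := @add_continuous G (x, 0); rewrite /continuous_at /= addr0.
    by move=> /(_ _ h1).
  case: h2 => -[V W] /= [Vx W0] VW.
  exists ([set y | V y /\ cmod (phi x - phi y) < e / 2], W) => /=.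
    by split=> //; exact: filterI.
  move=> [y u] /= [[Vy xy] Wu].
  rewrite -[X in X - _](subrK (phi x)) -addrA (le_lt_trans (cmodD _ _))//.
  by rewrite [ltRHS]splitr ltrD// cmodB; exact: (VW (y, u)).
move=> U0; exists [set u | closure [set x | phi x != 0] `<=`
    [set x | cmod (phi (x + u) - phi x) < e] /\
    closure [set x | phi x != 0] `<=`
    [set x | cmod (phi (x - u) - phi x) < e]].
  by apply: filterI => //; exact: (nbhs0_opp U0).
have sc z : phi z != 0 -> closure [set x | phi x != 0] z.
  by move=> z0; apply: subset_closure.
move=> x y [h1 h2].
have [y0|y0] := eqVneq (phi y) 0; last first.
  have := h1 y (sc _ y0); by rewrite /= addrCA subrr addr0.
have [x0|x0] := eqVneq (phi x) 0; first by rewrite x0 y0 subrr cmod0.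
have := h2 x (sc _ x0); by rewrite /= opprB addrCA subrr addr0 cmodB.
Qed.

Lemma Cc_flip phi t : Cc phi -> Cc (fun x => phi (t - x)).
Proof.
move=> [cphi cK]; have ct : continuous (fun x : G => t - x).
  move=> x; apply: (@continuous_comp G G G -%R (fun x => t + x)).
    exact: opp_continuous.
  exact: continuous_addl.
split.
  by move=> x; apply: continuous_comp; [exact: ct|exact: cphi].
apply: (@subclosed_compact _ _ ((fun x => t - x) @` closure [set x | phi x != 0])).
- exact: closed_closure.
- by apply: continuous_compact => //; exact: continuous_subspaceT.
- have cl : closed [set x | closure [set x | phi x != 0] (t - x)].
    by apply: closed_comp; [move=> x _; exact: ct|exact: closed_closure].
  move=> x xcl; exists (t - x); last by rewrite opprB addrCA subrr addr0.
  have := (closure_id _).1 cl => clE.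
  suff : closure [set x | closure [set x | phi x != 0] (t - x)] x by rewrite -clE.
  by move: xcl; apply: closureS => y /= y0; apply: subset_closure.
Qed.

End Cu.

(** * Borel sets and packings by translates *)

Section borel_sets.
Variable G : topologicalZmodType.
Implicit Types (A B K U V : set G).
Local Notation bm A := (@measurable _ (borel G) A).

Lemma bm_open U : open U -> bm U.
Proof. by move=> oU; apply: sub_sigma_algebra. Qed.

Lemma bm_closed A : closed A -> bm A.
Proof.
move=> cA; rewrite -(setCK A); apply: measurableC.
by apply: bm_open; exact: closed_openC.
Qed.

Lemma bm_compact (hausG : hausdorff_space G) K : compact K -> bm K.
Proof. by move=> cK; apply: bm_closed; exact: compact_closed. Qed.

Lemma bm_preimage (f : G -> G) : continuous f -> forall B, bm B -> bm (f @^-1` B).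
Proof.
move=> cf B mB.
have : measurable_fun (setT : set (borel G)) (f : borel G -> borel G).
  apply: (@measurability _ _ (borel G) (borel G) _ _ open) => // _ [U oU <-].
  by rewrite setTI; apply: bm_open; apply: open_comp => // x _; exact: cf.
by move=> /(_ measurableT _ mB); rewrite setTI.
Qed.

Lemma bm_addl t B : bm B -> bm [set x | B (t + x)].
Proof. by apply: bm_preimage; exact: continuous_addl. Qed.

Lemma bm_opp B : bm B -> bm [set x | B (- x)].
Proof. by apply: bm_preimage; exact: opp_continuous. Qed.

Lemma bm_oppset B : bm B -> bm (oppset B).
Proof. by rewrite oppsetE; exact: bm_opp. Qed.

(** An open set, namely a union of translates of [A], intersected with a set that is closed because
    [L] is compact. *)
Lemma bm_bdry L A : compact L -> open A -> bm (bdry L A).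
Proof.
move=> cL oA; apply: measurableI.
  by apply: bm_open; exact: open_shift.
by apply: bm_closed; apply: (@closed_shift_compact _ L (~` A)) => //; exact: open_closedC.
Qed.

Lemma continuous_bm_fun (R : realType) (f : G -> R) : continuous f ->
  measurable_fun (setT : set (borel G)) (f : borel G -> R).
Proof.
move=> cf; apply: (measurability _ (RGenOInfty.measurableE R)) => // _ [_ [x ->] <-].
rewrite setTI; apply: bm_open; apply: open_comp => // y _; exact: cf.
Qed.

Lemma uniform_bm_fun (R : realType) (f : G -> R) :
  (forall e : R, 0 < e -> exists2 U : set G, nbhs (0 : G) U &
     forall x y, U (x - y) -> `|f x - f y| < e) ->
  measurable_fun (setT : set (borel G)) (f : borel G -> R).
Proof.
move=> fu; apply: continuous_bm_fun => x; apply/cvgrPdist_lt => e /fu[U U0 fU].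
have := nbhs_subr x (nbhs0_opp U0); apply: filterS => y /=.
by rewrite opprB => /fU.
Qed.

Lemma Cu_Re_measurable (R : realType) (f : G -> R[i]) : Cu f ->
  measurable_fun (setT : set (borel G)) (fun x : borel G => complex.Re (f x)).
Proof.
move=> /CuP[_ fu]; apply: uniform_bm_fun => e /fu[U U0 fU]; exists U => // x y /fU.
by apply: le_lt_trans; rewrite -raddfB; exact: Re_le_cmod.
Qed.

Lemma Cu_Im_measurable (R : realType) (f : G -> R[i]) : Cu f ->
  measurable_fun (setT : set (borel G)) (fun x : borel G => complex.Im (f x)).
Proof.
move=> /CuP[_ fu]; apply: uniform_bm_fun => e /fu[U U0 fU]; exists U => // x y /fU.
by apply: le_lt_trans; rewrite -raddfB; exact: Im_le_cmod.
Qed.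

Lemma Cu_cmod_measurable (R : realType) (f : G -> R[i]) : Cu f ->
  measurable_fun (setT : set (borel G)) (fun x : borel G => cmod (f x)).
Proof.
move=> /CuP[_ fu]; apply: uniform_bm_fun => e /fu[U U0 fU]; exists U => // x y /fU.
by apply: le_lt_trans; exact: cmod_dist.
Qed.

End borel_sets.

Section packing.
Variable G : topologicalZmodType.
Implicit Types (A B D K U V : set G) (s : seq G).
Local Notation bm A := (@measurable _ (borel G) A).

(** Pairwise disjointness of the translates [y + V], in a recursive form that lets an induction
    split off one translate at a time. For nonempty [V] it also excludes repeated points. *)
Fixpoint packed V s : Prop := if s is y :: s' then
  (forall z v w, z \in s' -> V v -> V w -> y + v <> z + w) /\ packed V s'
  else True.

(** Stated for a set function that is merely nonnegative and additive under cutting, so that it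
    serves both Haar measure and [B |-> \int_B |h|]. The shift [u] is used for the second. *)
Lemma packed_superadditive (R : realType) (m : set G -> \bar R) V s u :
  (forall B, bm B -> 0 <= m B)%E ->
  (forall B C, bm B -> bm C -> m B = m (B `\` C) + m (B `&` C))%E ->
  open V -> packed V s ->
  forall B, bm B -> (forall y v, y \in s -> V v -> B (u + y + v)) ->
  (\sum_(y <- s) m [set x | V (- (u + y) + x)%R] <= m B)%E.
Proof.
move=> m0 mD oV; elim: s => [_ B mB _|y s IH [ys sP] B mB sB].
  by rewrite big_nil m0.
pose C := [set x | V (- (u + y) + x)].
have mC : bm C by apply: bm_open; exact: open_addl.
rewrite big_cons (mD B C mB mC) addeC leeD//.
  apply: IH => //; first exact: measurableD.
  move=> z v zs Vv; split; first by apply: sB => //; rewrite inE zs orbT.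
  rewrite /C /= => VC; apply: (ys z _ v zs VC Vv).
  by rewrite addrA opprD (addrCA y) subrr addr0 -(addrA u) addKr.
have -> : B `&` C = C => //.
apply/setIidr => x /= Vx; have := sB y _ (mem_head _ _) Vx.
by rewrite addNKr.
Qed.

End packing.

(** * Haar measure: coverings, maximal packings and reflection *)

Section haar.
Variables (R : realType) (G : topologicalZmodType).
Hypotheses (hausG : hausdorff_space G) (lcG : locally_compact [set: G]).
Variable haar : {measure set (borel G) -> \bar R}.
Hypothesis haarP : is_haar haar.
Implicit Types (A B D K U V : set G) (s : seq G).
Local Notation bm A := (@measurable _ (borel G) A).

Lemma haar_le A B : bm A -> bm B -> A `<=` B -> (haar A <= haar B)%E.
Proof. by move=> mA mB AB; apply: le_measure; rewrite ?inE. Qed.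

Lemma haar_addl t B : bm B -> haar [set x | B (t + x)] = haar B.
Proof.
case: haarP => _ _ inv mB; rewrite -(inv (- t) B mB); congr (haar _).
apply/seteqP; split=> [x Bx|_ [x Bx <-]] /=; last by rewrite addrA subrr add0r.
by exists (t + x) => //; rewrite addrA addNr add0r.
Qed.

Lemma precompact_haar_fin B : bm B -> precompact B -> haar B \is a fin_num.
Proof.
move=> mB; rewrite precompactE => cB; have [[hK _ _] _ _] := haarP.
rewrite ge0_fin_numE//; apply: le_lt_trans (hK _ cB).
apply: haar_le => //; first exact: bm_compact.
exact: subset_closure.
Qed.

Lemma haar_cover V s B : bm V -> bm B ->
  (forall x, B x -> exists2 y, y \in s & V (x - y)) ->
  (haar B <= (size s)%:R%:E * haar V)%E.
Proof.
move=> mV; elim: s B => [|y s IH] B mB Bs.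
  have -> : B = set0 by apply/seteqP; split=> // x /Bs[].
  by rewrite measure0 mul0e.
pose C := [set x | V (- y + x)].
have mC : bm C by exact: bm_addl.
rewrite (measureDI haar mB mC) /= -addn1 natrD EFinD ge0_muleDl// mul1e leeD//.
  apply: IH; first exact: measurableD.
  move=> x [/Bs[z]]; rewrite inE => /orP[/eqP ->|zs Vz _]; last by exists z.
  by rewrite /C /= addrC.
rewrite -(@haar_addl (- y) V mV); apply: haar_le => //; exact: measurableI.
Qed.

Lemma compact_cover_seq K V : compact K -> open V -> V 0 ->
  exists s, forall x, K x -> exists2 y, y \in s & V (x - y).
Proof.
move=> cK oV V0.
(* Lists directed by inclusion: a property near [F] holds for all lists containing some fixed one,
   which turns the near-covering form of compactness into a finite cover. *)
pose F : set_system (seq G) :=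
  filter_from setT (fun s0 => [set s : seq G | {subset s0 <= s}]).
have FF : Filter F.
  apply: filter_fromT_filter; first by exists [::].
  move=> s1 s2; exists (s1 ++ s2) => s /= ss.
  by split=> x xs; apply: ss; rewrite mem_cat xs ?orbT.
have : \forall s \near F, K `<=` [set x | exists2 y, y \in s & V (x - y)].
  move/compact_near_coveringP : cK; apply => x _.
  exists ([set y | V (y - x)], [set s : seq G | {subset [:: x] <= s}]) => /=.
    split; last by exists [:: x].
    by apply: nbhs_subr; exact: open_nbhs_nbhs.
  by move=> [y s] /= [Vyx xs]; exists x => //; apply: xs; rewrite mem_head.
by move=> [s _ h]; exists s; exact: (h s (fun _ => id)).
Qed.

(** If [V] were null, finite covers by translates would make every compact set null, and inner
    regularity would make the whole group null. *)
Lemma haar_open_gt0 V : open V -> V 0 -> (0 < haar V)%E.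
Proof.
move=> oV V0; have [[_ _ hin] h0 _] := haarP.
rewrite lt0e measure_ge0 andbT; move: h0; apply: contra_neq => hV.
apply/eqP; rewrite eq_le measure_ge0 andbT hin; last exact: openT.
apply: ge_ereal_sup => _ [K [cK _] <-].
have [s sK] := compact_cover_seq cK oV V0.
have := haar_cover (bm_open oV) (bm_compact hausG cK) sK.
by rewrite hV mule0.
Qed.

(** This is [D - V], hence [D + V] for the symmetric [V] in use; the existential form matches the
    two halves of [bdry]. In particular [fat V V] is [V - V]. *)
Definition fat V D : set G := [set x | exists2 v, V v & D (x + v)].

Lemma open_fat V D : open V -> open (fat V D).
Proof.
move=> oV; have -> : fat V D = \bigcup_(d in D) [set x | V (d - x)].
  apply/seteqP; split=> [x [v Vv Dx]|x [d Dd Vd]].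
    by exists (x + v) => //=; rewrite addrAC subrr add0r.
  by exists (d - x) => //; rewrite addrCA subrr addr0.
by apply: bigcup_open => d _; exact: (open_opp (open_addl d oV)).
Qed.

Lemma precompact_fat V D : precompact V -> precompact D -> precompact (fat V D).
Proof.
rewrite [precompact V]precompactE [precompact D]precompactE => cV cD.
have cK := compact_sumset cD (compact_oppset cV).
apply: (@precompact_subset _ _ (sumset (closure D) (oppset (closure V)))).
  move=> x [v Vv Dx]; exists (x + v); first exact: subset_closure.
  exists (- v); last by rewrite addrK.
  by exists v => //; exact: subset_closure.
by rewrite precompact_closed//; exact: compact_closed.
Qed.

Definition sym_nbhd V :=
  [/\ open V, V 0, (forall x, V x -> V (- x)) & precompact V].

Lemma packed_size D V s : sym_nbhd V -> packed V s -> (forall y, y \in s -> D y) ->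
  forall B, bm B -> fat V D `<=` B -> ((size s)%:R%:E * haar V <= haar B)%E.
Proof.
move=> [oV V0 sV pV] ps sD B mB DB.
have := @packed_superadditive G R haar V s 0 _ _ oV ps B mB.
have -> : (\sum_(y <- s) haar [set x | V (- (0 + y) + x)%R] =
           (size s)%:R%:E * haar V)%E.
  elim: s {ps sD} => [|y s IH]; first by rewrite big_nil mul0e.
  rewrite big_cons IH haar_addl; last exact: bm_open.
  by rewrite /= -[(size s).+1]addn1 natrD EFinD ge0_muleDl// mul1e addeC.
apply.
- by move=> *; exact: measure_ge0.
- by move=> B' C' mB' mC'; exact: measureDI.
- move=> y v ys Vv; apply: DB; exists (- v); first exact: sV.
  by rewrite add0r addrK; exact: sD.
Qed.

(** The finite Haar measure of [fat V D] bounds the number of disjoint translates, so greedy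
    extension stops. When it stops, [x + V] meets some [y + V] for every [x] in [D], which says that
    [x - y] lies in [V - V]. *)
Lemma packing D V : precompact D -> sym_nbhd V -> exists s, [/\ packed V s,
  (forall y, y \in s -> D y) &
  forall x, D x -> exists2 y, y \in s & fat V V (x - y)].
Proof.
move=> pD sV; have [oV V0 VN pV] := sV; apply: contrapT => nmax.
have big n : exists s, [/\ size s = n, packed V s & forall y, y \in s -> D y].
  elim: n => [|n [s [sn ps sD]]]; first by exists [::].
  have /existsNP[d /not_implyP[Dd nd]] :
      ~ forall x, D x -> exists2 y, y \in s & fat V V (x - y).
    by move=> h; apply: nmax; exists s.
  exists (d :: s); split; first by rewrite /= sn.
    split=> // z v w zs Vv Vw dvzw; apply: nd; exists z => //.
    exists v => //; by rewrite addrAC dvzw addrAC subrr add0r.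
  by move=> y; rewrite inE => /orP[/eqP->|/sD].
have pF := precompact_fat pV pD.
have mF : bm (fat V D) by apply: bm_open; exact: open_fat.
have fF := precompact_haar_fin mF pF.
have fV := precompact_haar_fin (bm_open oV) pV.
have V1 := haar_open_gt0 oV V0.
have V2 : 0 < fine (haar V) by rewrite -lte_fin fineK.
have F0 : 0 <= fine (haar (fat V D)) / fine (haar V).
  by rewrite divr_ge0// ?ltW// fine_ge0.
have [s [sn ps sD]] := big (Num.bound (fine (haar (fat V D)) / fine (haar V))).
have := packed_size sV ps sD mF (@subset_refl _ _).
rewrite sn leNgt -(fineK fV) -(fineK fF) -EFinM lte_fin -ltr_pdivrMr//.
by rewrite archi_boundP.
Qed.

(** Disjointness and [E i] being contained in [D] force the cells of index at least [n] to be empty,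
    so statements may quantify over all [i]. *)
Definition partitions D (E : nat -> set G) n :=
  [/\ forall i, bm (E i), forall i, E i `<=` D, trivIset setT E &
      D = \bigcup_(i < n) E i].

(** The sets [y + (V - V)] cover [D]; removing from each the earlier ones makes them disjoint and
    keeps every cell close to its own centre. Past the end of [s] the default centre [0] does no
    harm, since [D] is already exhausted. *)
Lemma cells D V : precompact D -> bm D -> sym_nbhd V -> exists s (E : nat -> set G),
  [/\ packed V s, (forall y, y \in s -> D y), partitions D E (size s) &
    forall i x, E i x -> fat V V (x - nth 0 s i)].
Proof.
move=> pD mD sV; have [oV _ _ _] := sV.
have [s [ps sD Ds]] := packing pD sV.
pose F i := D `&` [set x | fat V V (- nth 0 s i + x)].
have mF i : bm (F i).
  by apply: measurableI => //; apply: bm_open; apply: open_addl; exact: open_fat.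
exists s, (seqDU F); split => //.
- split; [exact: seqDU_measurable| |exact: trivIset_seqDU|].
    by move=> i x Eix; have [] := subset_seqDU Eix.
  rewrite bigcup_mkord -bigsetU_seqDU -bigcup_mkord.
  apply/seteqP; split=> [x Dx|x [i _ []//]].
  have [y ys Vxy] := Ds x Dx; exists (index y s); first by rewrite /= index_mem.
  by split => //=; rewrite nth_index// addrC.
- by move=> i x Eix; have [_] := subset_seqDU Eix; rewrite /= addrC.
Qed.

(* A substitute for the invariance of Haar measure under inversion, which would
   need its uniqueness. *)
Lemma oppset_haar V : sym_nbhd V -> exists2 C : R, 0 <= C & forall D B,
  bm D -> precompact D -> bm B -> fat V D `<=` B ->
  (haar (oppset D) <= C%:E * haar B)%E.
Proof.
move=> sV; have [oV V0 VN pV] := sV.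
have fV := precompact_haar_fin (bm_open oV) pV.
have oW : open (fat V V) by exact: open_fat.
have fW := precompact_haar_fin (bm_open oW) (precompact_fat pV pV).
have V2 : 0 < fine (haar V) by rewrite -lte_fin fineK// haar_open_gt0.
(* Each packed point occupies measure [haar V] inside [B], while [- D] is covered by equally many
   translates of [V - V]. *)
exists (fine (haar (fat V V)) / fine (haar V)).
  by rewrite divr_ge0// ?ltW// fine_ge0.
move=> D B mD pD mB DB; have [s [ps sD Ds]] := packing pD sV.
have sB := packed_size sV ps sD mB DB.
apply: (@le_trans _ _ ((size s)%:R%:E * haar (fat V V))%E).
  rewrite -(size_map -%R s); apply: haar_cover.
  - exact: bm_open.
  - exact: bm_oppset.
  move=> x; rewrite oppsetE => /Ds[y ys [v Vv Vxyv]].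
  exists (- y); first exact: map_f.
  exists (- v); first exact: VN.
  by have := VN _ Vxyv; rewrite !opprD !opprK.
apply: (@le_trans _ _ ((fine (haar (fat V V)) / fine (haar V))%:E *
    ((size s)%:R%:E * haar V))%E).
  rewrite -(fineK fV) -(fineK fW) -!EFinM lee_fin mulrCA.
  by rewrite divfK// gt_eqF.
by rewrite lee_wpmul2l// lee_fin divr_ge0// ?ltW// fine_ge0.
Qed.

End haar.

(** * Volumes of boundaries and of reflected sets *)

Section volume.
Variables (R : realType) (G : topologicalZmodType).
Hypotheses (hausG : hausdorff_space G) (lcG : locally_compact [set: G]).
Variable haar : {measure set (borel G) -> \bar R}.
Hypothesis haarP : is_haar haar.
Implicit Types (A B D K U V L : set G) (s : seq G).
Local Notation bm A := (@measurable _ (borel G) A).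

Definition vol B : R := fine (haar B).

Lemma vol_ge0 B : 0 <= vol B. Proof. by rewrite fine_ge0. Qed.

Lemma volE B : bm B -> precompact B -> haar B = (vol B)%:E.
Proof. by move=> mB pB; rewrite /vol fineK// precompact_haar_fin. Qed.

Lemma vol_le A B : bm A -> bm B -> precompact B -> A `<=` B -> vol A <= vol B.
Proof.
move=> mA mB pB AB; have pA := precompact_subset AB pB.
by rewrite -lee_fin -!volE//; exact: haar_le.
Qed.

Lemma precompactU A B : precompact A -> precompact B -> precompact (A `|` B).
Proof.
rewrite !precompactE closureU => cA cB; exact: compactU.
Qed.

Lemma vol_setU A B : bm A -> bm B -> precompact A -> precompact B ->
  vol (A `|` B) <= vol A + vol B.
Proof.
move=> mA mB pA pB; rewrite -lee_fin EFinD -!volE//; last 2 first.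
- exact: measurableU.
- exact: precompactU.
exact: measureU2.
Qed.

Lemma vol_gt0 V : sym_nbhd V -> 0 < vol V.
Proof.
move=> [oV V0 _ pV]; rewrite -lte_fin -volE//; last exact: bm_open.
exact: haar_open_gt0.
Qed.

Lemma packed_vol D V s : sym_nbhd V -> packed V s -> (forall y, y \in s -> D y) ->
  forall B, bm B -> precompact B -> fat V D `<=` B -> (size s)%:R * vol V <= vol B.
Proof.
move=> sV ps sD B mB pB DB; have [oV _ _ pV] := sV.
rewrite -lee_fin EFinM -!volE//; last exact: bm_open.
exact: packed_size DB.
Qed.

Lemma precompact_oppset A : precompact A -> precompact (oppset A).
Proof.
move=> [K AK [cK clK]]; exists (oppset K); first by rewrite !oppsetE => x /AK.
by split; [exact: compact_oppset|rewrite oppsetE; exact: closed_opp].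
Qed.

Lemma oppset_vol V : sym_nbhd V -> exists2 C : R, 0 <= C & forall D B,
  bm D -> precompact D -> bm B -> precompact B -> fat V D `<=` B ->
  vol (oppset D) <= C * vol B.
Proof.
move=> sV; have [C C0 hC] := oppset_haar hausG haarP sV; exists C => //.
move=> D B mD pD mB pB DB; rewrite -lee_fin EFinM -!volE//; first exact: hC.
- exact: bm_oppset.
- exact: precompact_oppset.
Qed.

Lemma exists_sym_nbhd U : nbhs (0 : G) U -> exists2 V, sym_nbhd V &
  forall x y, fat V V x -> fat V V y -> U (x - y).
Proof.
move=> /(small_nbhs lcG)[V [oV V0 VN cV VU]]; exists V.
  by split => //; rewrite precompactE.
move=> x y [v Vv Vxv] [w Vw Vyw].
have := VU (x + v) (- v) (- (y + w)) w Vxv (VN _ Vv) (VN _ Vyw) Vw.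
by rewrite addrK opprD addrNK.
Qed.

Lemma precompact_bdry L A : compact L -> precompact A -> precompact (bdry L A).
Proof.
move=> cL; rewrite [precompact A]precompactE => cA.
apply: (@precompact_subset _ _ (sumset (closure A) (oppset L))).
  move=> x [[l Ll Axl] _]; exists (x + l); first exact: subset_closure.
  by exists (- l); [exists l|rewrite addrK].
have cK := compact_sumset cA (compact_oppset cL).
by rewrite precompact_closed//; exact: compact_closed.
Qed.

Lemma fat_bdry V A : V 0 -> fat V A `<=` A `|` bdry (closure V) A.
Proof.
move=> V0 x [v Vv Axv].
by apply: (sumset_bdry _ _ Axv); exact: subset_closure.
Qed.

(** The form in which the van Hove property is used: about [bdry], with real volumes, and stable
    under reflection by [mean_vH_opp]. *)
Definition mean_vH (A : nat -> set G) : Prop :=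
  (forall n, [/\ open (A n), precompact (A n) & 0 < vol (A n)]) /\
  forall L, compact L -> forall e : R, 0 < e ->
    \forall n \near \oo, vol (bdry L (A n)) <= e * vol (A n).

(** Besides the inclusion [bdry_vH], comparing volumes requires [vH_boundary] to be Borel and
    precompact: the complement of [A n] shifted by a compact set is closed, and [A n + K] is
    precompact. *)
Lemma van_hove_mean (A : nat -> set G) : van_hove haar A -> mean_vH A.
Proof.
move=> [hA vA]; split.
  move=> n; have [oA pA A0] := hA n; split=> //.
  by rewrite -lte_fin -volE//; exact: bm_open.
move=> L cL e e0.
have cK : compact (L `|` oppset L).
  by apply: compactU => //; exact: compact_oppset.
have := vA _ cK => /cvgrPdist_lt/(_ _ e0); apply: filterS => n.
have [oA pA A0] := hA n.
have A0' : 0 < vol (A n) by rewrite -lte_fin -volE//; exact: bm_open.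
rewrite sub0r normrN => h; rewrite -ler_pdivrMr//.
apply: le_trans (ltW h); rewrite ger0_norm; last by rewrite divr_ge0// vol_ge0.
rewrite ler_pM2r ?invr_gt0//; move: cK; set K := L `|` oppset L => cK.
have pS : precompact (sumset (A n) K).
  move: pA; rewrite precompactE => cA.
  have cS := compact_sumset cA cK.
  apply: (@precompact_subset _ _ (sumset (closure (A n)) K)).
    move=> _ [x Ax [y Ky <-]]; exists x; first exact: subset_closure.
    by exists y.
  by rewrite precompact_closed//; exact: compact_closed.
apply: vol_le.
- exact: bm_bdry.
- apply: measurableU.
    apply: measurableD; first by apply: bm_closed; exact: closed_closure.
    exact: bm_open.
  apply: measurableI; last by apply: bm_closed; exact: closed_closure.
  apply: bm_closed.
  have -> : sumset (~` A n) (oppset K) = [set x | exists2 l, K l & (~` A n) (x + l)].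
    apply/seteqP; split=> [_ [x Ax [_ [y Ky <-] <-]]|x [l Kl Axl]].
      by exists y => //; rewrite subrK.
    by exists (x + l) => //; exists (- l); [exists l|rewrite addrK].
  by apply: closed_shift_compact => //; exact: open_closedC.
- apply: (@precompact_subset _ _ (closure (sumset (A n) K) `|` closure (A n))).
    by move=> x [[]|[]]; [left|right].
  move: pS pA; rewrite !precompactE => pS pA.
  have cc (B : set G) : closure (closure B) = closure B.
    by rewrite -(closure_id _).1//; exact: closed_closure.
  by rewrite closureU !cc; exact: compactU.
- exact: bdry_vH.
Qed.

(** The boundary of [- A n] is the reflection of a boundary of [A n], so [oppset_vol] bounds it by a
    slightly thicker boundary of [A n]. *)
Lemma oppset_bdry_small (A : nat -> set G) : mean_vH A ->
  forall L, compact L -> forall e : R, 0 < e ->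
    \forall n \near \oo, vol (bdry L (oppset (A n))) <= e * vol (A n).
Proof.
move=> [hA vA] L cL e e0.
have [V sV _] := exists_sym_nbhd (filterT : nbhs (0 : G) setT).
have [oV V0 VN pV] := sV.
have [C C0 hC] := oppset_vol sV.
(* [C + 1] in place of [C] keeps the divisor positive; the same device recurs below. *)
have C1 : 0 < C + 1 by rewrite ltr_wpDl.
pose L' := sumset (oppset L) (oppset (closure V)).
have cL' : compact L'.
  apply: compact_sumset; apply: compact_oppset => //.
  by move: pV; rewrite precompactE.
have := vA L' cL' (e / (C + 1)) (divr_gt0 e0 C1); apply: filterS => n.
have [oA pA A0] := hA n => h.
have -> : bdry L (oppset (A n)) = oppset (bdry (oppset L) (A n)).
  rewrite [in RHS]oppsetE; apply/seteqP; split=> x /=; first exact: bdry_opp.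
  move=> hx; have := @bdry_opp _ (oppset L) (oppset (A n)) (- x).
  rewrite !opprK => hh.
  by rewrite !oppsetK in hh; exact: hh.
have := hC (bdry (oppset L) (A n)) (bdry L' (A n)).
have cOL : compact (oppset L) by exact: compact_oppset.
move=> /(_ (bm_bdry cOL oA) (precompact_bdry cOL pA) (bm_bdry cL' oA)
   (precompact_bdry cL' pA)) => h'.
apply: (@le_trans _ _ (C * vol (bdry L' (A n)))).
  apply: h' => x [v Vv /bdry_add] /(_ (closure V) (- v)).
  rewrite addrK; apply; exact/subset_closure/VN.
apply: (@le_trans _ _ ((C + 1) * vol (bdry L' (A n)))).
  by rewrite ler_wpM2r ?vol_ge0// lerDl.
by rewrite mulrC -ler_pdivlMr// mulrAC.
Qed.

Lemma oppset_vol_le (A : nat -> set G) : mean_vH A -> exists2 C : R, 0 < C &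
  \forall n \near \oo, vol (oppset (A n)) <= C * vol (A n).
Proof.
move=> [hA vA].
have [V sV _] := exists_sym_nbhd (filterT : nbhs (0 : G) setT).
have [oV V0 VN pV] := sV.
have cV : compact (closure V) by move: pV; rewrite precompactE.
have [C C0 hC] := oppset_vol sV.
(* The [2] accounts for [A n] together with a boundary of at most the same volume, the [1] for
   strict positivity. *)
exists (C * 2 + 1); first by rewrite ltr_wpDl// mulr_ge0.
have := vA _ cV 1 ltr01; apply: filterS => n h.
have [oA pA A0] := hA n.
have := hC (A n) (A n `|` bdry (closure V) (A n)).
have mA : bm (A n) by exact: bm_open.
have mB : bm (bdry (closure V) (A n)) by exact: bm_bdry.
have pB := precompact_bdry cV pA.
move=> /(_ mA pA (measurableU _ _ mA mB) (precompactU pA pB) (fat_bdry V0)) h2.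
apply: (le_trans h2); rewrite mulrDl -mulrA.
have : vol (A n `|` bdry (closure V) (A n)) <= 2 * vol (A n).
  rewrite (le_trans (vol_setU mA mB pA pB))//.
  by rewrite mulrDl mul1r lerD2l (le_trans h)// mul1r.
move=> /(ler_wpM2l C0) h3; rewrite (le_trans h3)// lerDl mul1r; exact: ltW.
Qed.

(** [oppset_bdry_small] still measures against [vol (A n)]. Reflecting the reflected set bounds
    [vol (A n)] by a multiple of the volume of [- A n]. *)
Lemma mean_vH_opp (A : nat -> set G) : mean_vH A -> mean_vH (fun n => oppset (A n)).
Proof.
move=> vHA; have [hA vA] := vHA.
have oOA n : open (oppset (A n)).
  by rewrite oppsetE; apply: open_opp; have [] := hA n.
have pOA n : precompact (oppset (A n)).
  by apply: precompact_oppset; have [] := hA n.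
split.
  move=> n; split=> //; rewrite -lte_fin -volE//; last exact: bm_open.
  have [a Aa] : A n !=set0.
    apply/set0P/eqP => A0; have [_ _] := hA n.
    by rewrite A0 /vol measure0 ltxx.
  rewrite -(@haar_addl _ _ _ haarP (- a))//; last exact: bm_open.
  apply: haar_open_gt0 => //; first exact: open_addl.
  by rewrite /= addr0; exists a.
have [V sV _] := exists_sym_nbhd (filterT : nbhs (0 : G) setT).
have [oV V0 VN pV] := sV.
have cV : compact (closure V) by move: pV; rewrite precompactE.
have [C C0 hC] := oppset_vol sV.
have C1 : 0 < C + 1 by rewrite ltr_wpDl.
move=> L cL e e0.
have h1 : \forall n \near \oo, vol (A n) <= (C * 2) * vol (oppset (A n)).
  (* With this coefficient the boundary term contributes at most half of [vol (A n)], and is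
     absorbed into the left-hand side. *)
  have : 0 < (2 * (C + 1))^-1 by rewrite invr_gt0 mulr_gt0.
  move=> /(oppset_bdry_small vHA cV); apply: filterS => n h.
  have := hC (oppset (A n)) (oppset (A n) `|` bdry (closure V) (oppset (A n))).
  have mA : bm (oppset (A n)) by exact: bm_open.
  have mB : bm (bdry (closure V) (oppset (A n))) by exact: bm_bdry.
  have pB := precompact_bdry cV (pOA n).
  move=> /(_ mA (pOA n) (measurableU _ _ mA mB) (precompactU (pOA n) pB)
    (fat_bdry V0)).
  rewrite oppsetK => h2; have h3 := vol_setU mA mB (pOA n) pB.
  have h4 : vol (A n) <= C * vol (oppset (A n)) + C * ((2 * (C + 1))^-1 * vol (A n)).
    rewrite -mulrDr (le_trans h2)// ler_wpM2l// (le_trans h3)// lerD2l.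
    by [].
  have h5 : C * ((2 * (C + 1))^-1 * vol (A n)) <= vol (A n) / 2.
    rewrite mulrA mulrC ler_wpM2l ?vol_ge0// invfM mulrCA ler_piMr//.
    by rewrite ler_pdivrMr// mul1r lerDl.
  lra.
have h2 := oppset_bdry_small vHA cL (divr_gt0 e0 (mulr_gt0 C1 (ltr0Sn R 1))).
near=> n.
have h1n : vol (A n) <= (C * 2) * vol (oppset (A n)) by near: n.
have h2n : vol (bdry L (oppset (A n))) <= e / ((C + 1) * 2) * vol (A n) by near: n.
apply: (le_trans h2n); apply: (@le_trans _ _ (e / ((C + 1) * 2) *
    ((C + 1) * 2 * vol (oppset (A n))))).
  apply: ler_wpM2l; first by rewrite ltW// divr_gt0// mulr_gt0.
  apply: (le_trans h1n); by rewrite ler_wpM2r ?vol_ge0// ler_wpM2r// lerDl.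
by rewrite mulrA divfK// gt_eqF// mulr_gt0.
Unshelve. all: by end_near. Qed.

End volume.

(** * Integration against complex Radon measures *)

Section cintegral_theory.
Variables (R : realType) (G : topologicalZmodType).
Hypothesis hausG : hausdorff_space G.
Variable m : {measure set (borel G) -> \bar R}.
Hypothesis mP : radon m.
Implicit Types (D E : set G) (f g : G -> R[i]).
Local Notation bm A := (@measurable _ (borel G) A).
Local Open Scope complex_scope.

Lemma radon_fin D : bm D -> precompact D -> m D \is a fin_num.
Proof.
move=> mD; rewrite precompactE => cD; have [hK _ _] := mP.
rewrite ge0_fin_numE//; apply: le_lt_trans (hK _ cD).
apply: le_measure; rewrite ?inE//; first exact: bm_compact.
exact: subset_closure.
Qed.

Lemma bounded_integrable D (f : G -> R) : bm D -> precompact D ->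
  measurable_fun (setT : set (borel G)) (f : borel G -> R) ->
  (exists M : R, forall x, `|f x| <= M) ->
  m.-integrable D (EFin \o (f : borel G -> R)).
Proof.
move=> mD pD mf [M fM]; apply: measurable_bounded_integrable => //.
- by have := radon_fin mD pD; rewrite ge0_fin_numE.
- exact: measurable_funS mf.
- exists M; split; first exact: num_real.
  by move=> N MN x _ /=; rewrite (le_trans (fM x))// ltW.
Qed.

Lemma Cu_integrable D f : bm D -> precompact D -> Cu f ->
  m.-integrable D (EFin \o (fun x : borel G => complex.Re (f x))) /\
  m.-integrable D (EFin \o (fun x : borel G => complex.Im (f x))).
Proof.
move=> mD pD cf; have [M _ fM] := Cu_bound cf.
split; apply: bounded_integrable => //.
- exact: Cu_Re_measurable.
- by exists M => x; rewrite (le_trans (Re_le_cmod _)).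
- exact: Cu_Im_measurable.
- by exists M => x; rewrite (le_trans (Im_le_cmod _)).
Qed.

Lemma cintegralD D f g : bm D -> precompact D -> Cu f -> Cu g ->
  cintegral m D (fun x => f x + g x) = cintegral m D f + cintegral m D g.
Proof.
move=> mD pD cf cg; have [fr fi] := Cu_integrable mD pD cf.
have [gr gi] := Cu_integrable mD pD cg.
rewrite /cintegral; apply/eqP; rewrite eq_complex /=; apply/andP; split; apply/eqP.
  rewrite -RintegralD//; apply: eq_Rintegral => x _; exact: raddfD.
rewrite -RintegralD//; apply: eq_Rintegral => x _; exact: raddfD.
Qed.

Lemma cintegralZ D (c : R[i]) f : bm D -> precompact D -> Cu f ->
  cintegral m D (fun x => c * f x) = c * cintegral m D f.
Proof.
move=> mD pD cf; have [fr fi] := Cu_integrable mD pD cf.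
case: c => a b.
rewrite /cintegral; apply/eqP; rewrite eq_complex /=; apply/andP; split; apply/eqP.
  rewrite -!RintegralZl// -RintegralB//; last 2 first.
  - exact: (integrableZl mD a fr).
  - exact: (integrableZl mD b fi).
  by apply: eq_Rintegral => x _; case: (f x).
rewrite -!RintegralZl// -RintegralD//; last 2 first.
- exact: (integrableZl mD a fi).
- exact: (integrableZl mD b fr).
by apply: eq_Rintegral => x _; case: (f x).
Qed.

Lemma cintegral_setU D E f : bm D -> bm E -> precompact D -> precompact E ->
  Cu f -> D `&` E = set0 ->
  cintegral m (D `|` E) f = cintegral m D f + cintegral m E f.
Proof.
move=> mD mE pD pE cf DE.
have [fr fi] := Cu_integrable (measurableU _ _ mD mE) (precompactU pD pE) cf.
have dDE : [disjoint D & E] by apply/disj_setPS; rewrite DE.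
by rewrite /cintegral; apply/eqP; rewrite eq_complex /= !Rintegral_setU// !eqxx.
Qed.

Lemma cintegral_set0 f : cintegral m set0 f = 0.
Proof. by rewrite /cintegral !Rintegral_set0. Qed.

Lemma cintegral_cst D (c : R[i]) : bm D ->
  cintegral m D (fun=> c) = c * (fine (m D))%:C.
Proof.
move=> mD; rewrite /cintegral !Rintegral_cst//; case: c => a b.
by apply/eqP; rewrite eq_complex /= !mulr0 subr0 add0r !eqxx.
Qed.

Lemma Rintegral_bound D (f : G -> R) (M : R) : bm D -> precompact D ->
  m.-integrable D (EFin \o (f : borel G -> R)) ->
  (forall x, D x -> `|f x| <= M) ->
  `|(\int[m]_(x in D) f x)%R| <= M * fine (m D).
Proof.
move=> mD pD fi fM; rewrite (le_trans (le_normr_Rintegral mD fi))//.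
rewrite -Rintegral_cst//; apply: le_Rintegral => //.
  by have := integrable_abse fi.
apply: measurable_bounded_integrable => //.
  by have := radon_fin mD pD; rewrite ge0_fin_numE.
exists `|M|; split; first exact: num_real.
by move=> N MN x _ /=; exact: ltW.
Qed.

(** The factor [2] comes from treating real and imaginary parts separately. *)
Lemma cintegral_bound D f (M : R) : bm D -> precompact D -> Cu f ->
  (forall x, D x -> cmod (f x) <= M) ->
  cmod (cintegral m D f) <= M * (2 * fine (m D)).
Proof.
move=> mD pD cf fM; have [fr fi] := Cu_integrable mD pD cf.
rewrite (le_trans (cmod_le_ReIm _))//= mulrCA mulrDl mul1r lerD//.
  by apply: Rintegral_bound => // x /fM; apply: le_trans; exact: Re_le_cmod.
by apply: Rintegral_bound => // x /fM; apply: le_trans; exact: Im_le_cmod.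
Qed.

Lemma cintegral_support D f : (forall x, ~ D x -> f x = 0) ->
  cintegral m setT f = cintegral m D f.
Proof.
move=> f0; rewrite /cintegral [in RHS]Rintegral_mkcond [X in _ = _ +i* X]Rintegral_mkcond.
apply/eqP; rewrite eq_complex /=; apply/andP; split; apply/eqP;
  apply: eq_Rintegral => x _; rewrite patchE; case: ifPn => //;
  by rewrite notin_setE => /f0 ->.
Qed.

End cintegral_theory.

Section mintegral_theory.
Variables (R : realType) (G : topologicalZmodType).
Hypothesis hausG : hausdorff_space G.
Variable mu : complex_radon G R.
Implicit Types (D E : set G) (f g : G -> R[i]).
Local Notation bm A := (@measurable _ (borel G) A).
Local Open Scope complex_scope.

Let rpP := re_pos_radon mu.
Let rnP := re_neg_radon mu.
Let ipP := im_pos_radon mu.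
Let inP := im_neg_radon mu.

Lemma mintegralD D f g : bm D -> precompact D -> Cu f -> Cu g ->
  mintegral mu D (fun x => f x + g x) = mintegral mu D f + mintegral mu D g.
Proof.
move=> mD pD cf cg; rewrite /mintegral.
rewrite (cintegralD hausG rpP)// (cintegralD hausG rnP)//.
rewrite (cintegralD hausG ipP)// (cintegralD hausG inP)//; ring.
Qed.

Lemma mintegralZ D (c : R[i]) f : bm D -> precompact D -> Cu f ->
  mintegral mu D (fun x => c * f x) = c * mintegral mu D f.
Proof.
move=> mD pD cf; rewrite /mintegral.
rewrite (cintegralZ hausG rpP)// (cintegralZ hausG rnP)//.
rewrite (cintegralZ hausG ipP)// (cintegralZ hausG inP)//; ring.
Qed.

Lemma mintegralB D f g : bm D -> precompact D -> Cu f -> Cu g ->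
  mintegral mu D (fun x => f x - g x) = mintegral mu D f - mintegral mu D g.
Proof.
move=> mD pD cf cg; rewrite -mulN1r -mintegralZ// -mintegralD//; last exact: CuZ.
by congr mintegral; apply/funext => x; rewrite mulN1r.
Qed.

Lemma mintegral_setU D E f : bm D -> bm E -> precompact D -> precompact E ->
  Cu f -> D `&` E = set0 ->
  mintegral mu (D `|` E) f = mintegral mu D f + mintegral mu E f.
Proof.
move=> mD mE pD pE cf DE; rewrite /mintegral.
rewrite (cintegral_setU hausG rpP)// (cintegral_setU hausG rnP)//.
rewrite (cintegral_setU hausG ipP)// (cintegral_setU hausG inP)//; ring.
Qed.

Lemma mintegral_set0 f : mintegral mu set0 f = 0.
Proof. by rewrite /mintegral !cintegral_set0 !subrr mulr0 addr0. Qed.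

Lemma mintegral_cst D (c : R[i]) : bm D ->
  mintegral mu D (fun=> c) = c * mass mu D.
Proof.
move=> mD; rewrite /mintegral !cintegral_cst//.
have -> : mass mu D = ((fine (re_pos mu D))%:C - (fine (re_neg mu D))%:C) +
    'i%C * ((fine (im_pos mu D))%:C - (fine (im_neg mu D))%:C).
  by rewrite -!rmorphB /mass [LHS]complexE /=.
ring.
Qed.

Lemma mintegral_support D f : (forall x, ~ D x -> f x = 0) ->
  functional mu f = mintegral mu D f.
Proof. by move=> f0; rewrite /functional /mintegral !(cintegral_support _ f0). Qed.

Lemma mintegral_sum D n (F : 'I_n -> G -> R[i]) : bm D -> precompact D ->
  (forall i, Cu (F i)) ->
  mintegral mu D (fun x => \sum_(i < n) F i x) = \sum_(i < n) mintegral mu D (F i).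
Proof.
move=> mD pD; elim: n F => [F _|n IH F FC].
  under eq_fun do rewrite big_ord0.
  by rewrite big_ord0 mintegral_cst// mul0r.
under eq_fun do rewrite big_ord_recr.
rewrite big_ord_recr/= mintegralD//; last exact: Cu_sum.
by rewrite IH.
Qed.

Lemma mintegral_eq0 D f : bm D -> (forall x, D x -> f x = 0) ->
  mintegral mu D f = 0.
Proof.
move=> mD f0; rewrite -[RHS](mul0r (mass mu D)) -mintegral_cst// /mintegral.
have f0E m : cintegral m D f = cintegral m D (fun=> 0).
  by rewrite /cintegral; congr Complex; apply: eq_Rintegral => x /set_mem/f0 ->.
by rewrite !f0E.
Qed.

(* The four parts of [mu] need not be mutually singular, so [total] may be much
   larger than the variation; it only serves for errors that tend to [0] while
   [D] is fixed. *)
Definition total D : R := 2 * (fine (re_pos mu D) + fine (re_neg mu D) +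
   (fine (im_pos mu D) + fine (im_neg mu D))).

Lemma total_ge0 D : 0 <= total D.
Proof. by rewrite mulr_ge0// !addr_ge0// fine_ge0. Qed.

Lemma mintegral_total D f (M : R) : bm D -> precompact D -> Cu f ->
  (forall x, D x -> cmod (f x) <= M) ->
  cmod (mintegral mu D f) <= M * total D.
Proof.
move=> mD pD cf fM; rewrite /mintegral (le_trans (cmodD _ _))//.
rewrite cmodM cmod_i mul1r /total mulrDr mulrDr lerD//.
  rewrite (le_trans (cmodD _ _))// cmodN [2 * _]mulrDr mulrDr.
  by rewrite lerD//; [apply: (cintegral_bound hausG rpP)|apply: (cintegral_bound hausG rnP)].
rewrite (le_trans (cmodD _ _))// cmodN [2 * _]mulrDr mulrDr.
by rewrite lerD//; [apply: (cintegral_bound hausG ipP)|apply: (cintegral_bound hausG inP)].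
Qed.

(** The integrand is frozen at one point of [C]: the constant part pays with the mass, and only the
    oscillation pays with [total]. *)
Lemma mintegral_osc C h (b d : R) : bm C -> precompact C -> Cu h -> 0 <= b ->
  (forall x, C x -> cmod (h x) <= b) ->
  (forall x y, C x -> C y -> cmod (h x - h y) <= d) ->
  cmod (mintegral mu C h) <= b * cmod (mass mu C) + d * total C.
Proof.
move=> mC pC ch b0 hb hd.
have [->|/set0P[z Cz]] := eqVneq C set0.
  have t0 : total set0 = 0 by rewrite /total !measure0 /= !addr0 mulr0.
  by rewrite mintegral_set0 cmod0 t0 mulr0 addr0 mulr_ge0// cmod_ge0.
have -> : mintegral mu C h =
    h z * mass mu C + mintegral mu C (fun x => h x - h z).
  rewrite mintegralB//; last exact: Cu_cst.
  by rewrite mintegral_cst// addrC subrK.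
rewrite (le_trans (cmodD _ _))// lerD//.
  by rewrite cmodM ler_wpM2r ?cmod_ge0// hb.
apply: mintegral_total => //.
  by apply: CuB => //; exact: Cu_cst.
by move=> x Cx; exact: hd.
Qed.

End mintegral_theory.

Section additive_cells.
Variables (G : topologicalZmodType).
Implicit Types (D : set G) (E : nat -> set G).
Local Notation bm A := (@measurable _ (borel G) A).

(** The target is an arbitrary additive group because the lemma is applied to [mass], to [total] and
    to [mintegral]. *)
Lemma additive_cells (W : zmodType) (F : set G -> W) D E n :
  F set0 = 0 ->
  (forall A B, bm A -> bm B -> precompact A -> precompact B -> A `&` B = set0 ->
    F (A `|` B) = F A + F B) ->
  precompact D -> partitions D E n -> F D = \sum_(i < n) F (E i).
Proof.
move=> F0 FU pD [mE ED tE ->]; elim: n => [|n IH].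
  by rewrite big_ord0 bigcup_mkord big_ord0.
rewrite bigcup_mkord !big_ord_recr /= -bigcup_mkord FU//; first 1 last.
- by apply: bigcup_measurable.
- by apply: (@precompact_subset _ _ D) => // x [i /= ilt]; exact: ED.
- by apply: (@precompact_subset _ _ D) => // x; exact: ED.
- apply/seteqP; split => // x [[i /= ilt Ei] En].
  have iE : i = n by apply: tE => //; exists x.
  by rewrite iE ltnn in ilt.
by rewrite IH.
Qed.

Lemma partitions_setI D E n C : bm C -> C `<=` D -> partitions D E n ->
  partitions C (fun i => C `&` E i) n.
Proof.
move=> mC CD [mE ED tE DE]; split.
- by move=> i; exact: measurableI.
- by move=> i x [].
- by move=> i j _ _ [x [[_ Ei] [_ Ej]]]; apply: tE => //; exists x.
- apply/seteqP; split=> [x Cx|x [i _ []//]].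
  by have := CD x Cx; rewrite DE => -[i ilt Eix]; exists i.
Qed.

End additive_cells.

(** * The variation and the bounds it gives for integrals *)

Section variation.
Variables (R : realType) (G : topologicalZmodType).
Hypotheses (hausG : hausdorff_space G) (lcG : locally_compact [set: G]).
Variable mu : complex_radon G R.
Implicit Types (A B C D : set G) (E : nat -> set G) (h : G -> R[i]).
Local Notation bm A := (@measurable _ (borel G) A).

Lemma mass_mintegral D : bm D -> mass mu D = mintegral mu D (fun=> 1).
Proof. by move=> mD; rewrite mintegral_cst// mul1r. Qed.

Lemma mass_set0 : mass mu set0 = 0.
Proof. by rewrite mass_mintegral// mintegral_set0. Qed.

Lemma mass_setU A B : bm A -> bm B -> precompact A -> precompact B ->
  A `&` B = set0 -> mass mu (A `|` B) = mass mu A + mass mu B.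
Proof.
move=> mA mB pA pB AB; rewrite !mass_mintegral//; last exact: measurableU.
by rewrite mintegral_setU//; exact: Cu_cst.
Qed.

Lemma total_set0 : total mu set0 = 0.
Proof. by rewrite /total !measure0 /= !addr0 mulr0. Qed.

Lemma total_setU A B : bm A -> bm B -> precompact A -> precompact B ->
  A `&` B = set0 -> total mu (A `|` B) = total mu A + total mu B.
Proof.
move=> mA mB pA pB AB.
have add (m : {measure set (borel G) -> \bar R}) : radon m ->
    fine (m (A `|` B)) = fine (m A) + fine (m B).
  by move=> mP; rewrite measureU// fineD//; exact: (radon_fin hausG mP).
rewrite /total (add _ (re_pos_radon mu)) (add _ (re_neg_radon mu)).
rewrite (add _ (im_pos_radon mu)) (add _ (im_neg_radon mu)); ring.
Qed.

Lemma variation_mono A B : A `<=` B ->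
  (variation_measure mu A <= variation_measure mu B)%E.
Proof.
move=> AB; apply: ereal_sup_le => s [n [F [hF tF ->]]]; exists n, F; split=> //.
by move=> k kn; have [? ? FA] := hF k kn; split=> // x /FA /AB.
Qed.

Lemma variation_ge0 A : (0 <= variation_measure mu A)%E.
Proof.
apply: ereal_sup_ubound; exists 0%N, (fun=> set0); split => //.
by rewrite big_ord0.
Qed.

(** Transfers the defining families, indexed by initial segments of [nat], to any finite index type;
    pairs of indices arise from the intersection of two partitions. *)
Lemma variation_fin (I : finType) (F : I -> set G) B :
  (forall i, bm (F i)) -> (forall i, precompact (F i)) -> (forall i, F i `<=` B) ->
  (forall i j x, F i x -> F j x -> i = j) ->
  ((\sum_i cmod (mass mu (F i)))%:E <= variation_measure mu B)%E.
Proof.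
move=> mF pF FB dF; apply: ereal_sup_ubound.
pose F' k := if insub k : option 'I_#|I| is Some o then F (enum_val o) else set0.
have F'E (o : 'I_#|I|) : F' o = F (enum_val o) by rewrite /F' valK.
exists #|I|, F'; split.
- by move=> k kI; rewrite (F'E (Ordinal kI)); split.
- move=> i j iI jI [x []]; rewrite (F'E (Ordinal iI)) (F'E (Ordinal jI)) => xi xj.
  by have /enum_val_inj[] := dF _ _ _ xi xj.
- congr EFin; rewrite (big_enum_val (fun i => cmod (mass mu (F i))))/=.
  by apply: eq_bigr => o _; rewrite F'E.
Qed.

(** Every test set is cut along the cells; for a fixed cell the pieces form a test family of that
    cell. *)
Lemma variation_cells D E n (v : nat -> R) : precompact D -> bm D ->
  partitions D E n -> (forall i, (i < n)%N -> (variation_measure mu (E i) <= (v i)%:E)%E) ->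
  (variation_measure mu D <= (\sum_(i < n) v i)%:E)%E.
Proof.
move=> pD mD PE vE; have [mE ED tE DE] := PE.
apply: ge_ereal_sup => _ [k [F [hF tF ->]]].
rewrite lee_fin (@le_trans _ _ (\sum_(j < k) \sum_(i < n) cmod (mass mu (F j `&` E i))))//.
  apply: ler_sum => j _; have [mF pF FD] := hF j (ltn_ord j).
  rewrite (additive_cells mass_set0 mass_setU pF (partitions_setI mF FD PE)).
  exact: cmod_sum.
rewrite exchange_big/=; apply: ler_sum => i _.
rewrite -lee_fin; apply: le_trans (vE i (ltn_ord i)).
apply: (@variation_fin _ (fun j : 'I_k => F j `&` E i)).
- by move=> j; have [mF _ _] := hF j (ltn_ord j); exact: measurableI.
- move=> j; have [_ pF _] := hF j (ltn_ord j).
  by apply: precompact_subset pF => x [].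
- by move=> j x [].
- move=> j j' x [Fj _] [Fj' _]; apply: val_inj; apply: tF => //=.
  by exists x.
Qed.

Variable haar : {measure set (borel G) -> \bar R}.
Hypothesis haarP : is_haar haar.

Lemma small_cells D (U : set G) : precompact D -> bm D -> nbhs (0 : G) U ->
  exists n E, partitions D E n /\ forall i x y, E i x -> E i y -> U (x - y).
Proof.
move=> pD mD /(exists_sym_nbhd lcG)[V sV VU].
have [s [E [_ _ PE EV]]] := cells hausG haarP pD mD sV.
exists (size s), E; split=> // i x y /EV Vx /EV Vy.
by have := VU _ _ Vx Vy; rewrite opprB addrA subrK.
Qed.

(* The cells [E i] are refined until [h] almost does not oscillate; the masses of
   the refined cells then add up to at most the variation. *)
Lemma mintegral_cells D E n h e (w : R) (b v : nat -> R) :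
  bm D -> precompact D -> partitions D E n -> Cu h -> 0 <= e ->
  (forall i, 0 <= b i) ->
  (forall i x, (i < n)%N -> E i x -> cmod (h x) <= e + b i) ->
  (variation_measure mu D <= w%:E)%E ->
  (forall i, (i < n)%N -> (variation_measure mu (E i) <= (v i)%:E)%E) ->
  cmod (mintegral mu D h) <= e * w + \sum_(i < n) b i * v i.
Proof.
move=> mD pD PE ch e0 b0 hb vD vE; apply/ler_addgt0Pr => d d0.
have t0 := total_ge0 mu D.
(* The slack [d] pays for the oscillation on the refined cells, whose [total] adds up to that of
   [D]. *)
have d1 : 0 < d / (total mu D + 1) by rewrite divr_gt0// ltr_wpDl.
have /CuP[_ /(_ _ d1)[U U0 hU]] := ch.
have [k [E' [PE' E'U]]] := small_cells pD mD U0.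
have [mE ED tE DE] := PE; have [mE' ED' tE' DE'] := PE'.
have pE i : precompact (E i) by exact: precompact_subset pD.
have mI i j : bm (E i `&` E' j) by exact: measurableI.
have pI i j : precompact (E i `&` E' j).
  by apply: precompact_subset (pE i) => x [].
have PI i := partitions_setI (mE i) (ED i) PE'.
pose M i j := cmod (mass mu (E i `&` E' j)).
pose T i j := total mu (E i `&` E' j).
have mint_add : forall A B, bm A -> bm B -> precompact A -> precompact B ->
    A `&` B = set0 -> mintegral mu (A `|` B) h = mintegral mu A h + mintegral mu B h.
  by move=> *; exact: mintegral_setU.
have mint0 := mintegral_set0 mu h.
have TD : \sum_(i < n) \sum_(j < k) T i j = total mu D.
  rewrite (additive_cells total_set0 total_setU pD PE).
  by apply: eq_bigr => i _; rewrite (additive_cells total_set0 total_setU (pE i) (PI i)).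
have MD : \sum_(i < n) \sum_(j < k) M i j <= w.
  rewrite pair_bigA/= -lee_fin; apply: le_trans vD.
  apply: (@variation_fin _ (fun p : 'I_n * 'I_k => E p.1 `&` E' p.2)).
  - by move=> p; exact: mI.
  - by move=> p; exact: pI.
  - by move=> p x [_ /ED'].
  move=> [i j] [i' j'] x /= [Ei Ej] [Ei' Ej'].
  congr pair; apply: val_inj; [apply: tE|apply: tE'] => //; by exists x.
have ME i : (i < n)%N -> \sum_(j < k) M i j <= v i.
  move=> ilt; rewrite -lee_fin; apply: le_trans (vE i ilt).
  apply: (@variation_fin _ (fun j : 'I_k => E i `&` E' j)).
  - by move=> j; exact: mI.
  - by move=> j; exact: pI.
  - by move=> j x [].
  move=> j j' x /= [_ Ej] [_ Ej'].
  apply: val_inj; apply: tE' => //; by exists x.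
rewrite (additive_cells mint0 mint_add pD PE) (le_trans (cmod_sum _ _ _))//.
rewrite (@le_trans _ _ (\sum_(i < n) ((e + b i) * (\sum_(j < k) M i j) +
    d / (total mu D + 1) * (\sum_(j < k) T i j))))//.
  apply: ler_sum => i _; rewrite (additive_cells mint0 mint_add (pE i) (PI i)).
  rewrite (le_trans (cmod_sum _ _ _))// !mulr_sumr -big_split/=.
  apply: ler_sum => j _; apply: mintegral_osc => //.
  - by rewrite addr_ge0.
  - by move=> x [Eix _]; exact: hb.
  - by move=> x y [_ Ejx] [_ Ejy]; apply/ltW/hU; exact: (E'U j).
rewrite big_split/= -mulr_sumr TD lerD//; last first.
  by rewrite mulrAC ler_pdivrMr ?ltr_wpDl// ler_wpM2l ?(ltW d0)// lerDl.
(* The uniform part [e] is charged to the variation of all of [D], the local parts [b i] to the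
   variations of their cells; this keeps the first charge independent of the size of the cells. *)
under eq_bigr do rewrite mulrDl.
rewrite big_split/= -mulr_sumr lerD//; first by rewrite ler_wpM2l.
by apply: ler_sum => i _; rewrite ler_wpM2l// ME.
Qed.

Lemma mintegral_variation D h (b w : R) : bm D -> precompact D -> Cu h -> 0 <= b ->
  (forall x, D x -> cmod (h x) <= b) -> (variation_measure mu D <= w%:E)%E ->
  cmod (mintegral mu D h) <= b * w.
Proof.
move=> mD pD ch b0 hb vD.
(* The partition into a single cell, used with local part [0]. *)
have PD : partitions D (fun i => if i is 0 then D else set0) 1.
  split=> [[|i]//|[|i] x//| [|i] [|j] _ _ [x []]//|].
  by apply/seteqP; split=> [x Dx|x [[|i] //]]; exists 0%N.
have := @mintegral_cells D _ 1 h b w (fun=> 0) (fun=> w) mD pD PD ch b0 _ _ vD.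
rewrite big_ord1 mul0r !addr0; apply => //; last by case.
by case=> [|//] x _ Dx; rewrite ?addr0; exact: hb.
Qed.

End variation.

(** * Convolutions and exchange of iterated integrals *)

Section convolution.
Variables (R : realType) (G : topologicalZmodType).
Hypotheses (hausG : hausdorff_space G) (lcG : locally_compact [set: G]).
Variable haar : {measure set (borel G) -> \bar R}.
Hypothesis haarP : is_haar haar.
Implicit Types (mu nu : complex_radon G R) (A B C D : set G) (E : nat -> set G).
Implicit Types (h phi : G -> R[i]).
Local Notation bm A := (@measurable _ (borel G) A).

(** One constant for all sets that fit into some translate of [D]; cells of a packing do so without
    being translates themselves. *)
Lemma tb_precompact mu D : translation_bounded mu -> precompact D ->
  exists2 C : R, 0 <= C & forall u A, (forall x, A x -> D (x - u)) ->
    (variation_measure mu A <= C%:E)%E.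
Proof.
move=> tb; rewrite precompactE => cD; have [C hC] := tb _ cD; exists C.
  by rewrite -lee_fin; apply: le_trans (hC 0); exact: variation_ge0.
move=> u A AD; apply: le_trans (hC u); apply: variation_mono => x Ax.
by exists (x - u); [exact/subset_closure/AD|rewrite addrC subrK].
Qed.

Lemma Cu_mintegral mu D phi : bm D -> precompact D -> Cu phi ->
  Cu (fun t => mintegral mu D (fun s => phi (t + s))).
Proof.
move=> mD pD cphi; have [M _ phiM] := Cu_bound cphi.
have t0 := total_ge0 mu D; apply/CuP; split.
  exists (M * total mu D) => t; apply: mintegral_total => //; exact: Cu_addl.
move=> e e0; have e1 : 0 < e / (total mu D + 1) by rewrite divr_gt0// ltr_wpDl.
have /CuP[_ /(_ _ e1)[U U0 hU]] := cphi; exists U => // x y Uxy.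
rewrite -mintegralB; [|by []|by []|by []|exact: Cu_addl|exact: Cu_addl].
apply: (@le_lt_trans _ _ (e / (total mu D + 1) * total mu D)).
  apply: mintegral_total => //.
    by apply: CuB; exact: Cu_addl.
  move=> s _; apply/ltW/hU; by rewrite opprD addrACA subrr addr0.
by rewrite mulrAC ltr_pdivrMr ?ltr_wpDl// ltr_pM2l// ltrDl.
Qed.

(** The window [x + L] contains the supports of [s |-> phi (y - s)] for all [y] with [x - y] in [V].
    Values at nearby points are thus integrals over the same set, whose variation is bounded
    independently of [x]. *)
Lemma Cu_convolution mu phi : translation_bounded mu -> Cc phi ->
  Cu (convolution mu phi).
Proof.
move=> tb cphi; have cuphi := Cc_Cu cphi; have [M M0 phiM] := Cu_bound cuphi.
have [V sV _] := exists_sym_nbhd lcG (filterT : nbhs (0 : G) setT).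
have [oV V0 VN pV] := sV.
pose K := closure [set x | phi x != 0].
have KP x : ~ K x -> phi x = 0.
  move=> nK; apply/eqP; apply/negP => /negP x0; apply: nK.
  by apply: subset_closure.
have cV : compact (closure V) by move: pV; rewrite precompactE.
have cK : compact K by case: cphi.
pose L := sumset (oppset K) (closure V).
have cL : compact L by apply: compact_sumset => //; exact: compact_oppset.
have pL : precompact L.
  by rewrite precompact_closed//; exact: compact_closed.
have [C C0 hC] := tb_precompact tb pL.
pose D x := [set s | L (- x + s)].
have mD x : bm (D x) by apply: bm_addl; exact: bm_compact.
have pD x : precompact (D x).
  have cS := compact_sumset (@compact_set1 _ x) cL.
  apply: (@precompact_subset _ _ (sumset [set x] L)).
    by move=> s Ds; exists x => //; exists (- x + s) => //; rewrite addNKr.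
  by rewrite precompact_closed//; exact: compact_closed.
have vD x : (variation_measure mu (D x) <= C%:E)%E.
  by apply: (hC x) => s; rewrite /D /= addrC.
have conv x y : V (x - y) ->
    convolution mu phi y = mintegral mu (D x) (fun s => phi (y - s)).
  move=> Vxy; apply: mintegral_support => s nD; apply: KP => Ks; apply: nD.
  exists (s - y); first by exists (y - s) => //; rewrite opprB.
  exists (y - x); first by apply: subset_closure; rewrite -opprB; exact: VN.
  by rewrite addrA subrK addrC.
apply/CuP; split.
  exists (M * C) => x; rewrite (conv x x) ?subrr//.
  by apply: (mintegral_variation hausG lcG haarP) => //; exact: Cu_flip.
move=> e e0; have e1 : 0 < e / (C + 1) by rewrite divr_gt0// ltr_wpDl.
have /CuP[_ /(_ _ e1)[U U0 hU]] := cuphi.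
exists (U `&` V); first by apply: filterI => //; exact: open_nbhs_nbhs.
move=> x y [Uxy Vxy]; rewrite (conv x x) ?subrr// (conv x y)//.
rewrite -mintegralB; [|by []|by []|by []|exact: Cu_flip|exact: Cu_flip].
apply: (@le_lt_trans _ _ (e / (C + 1) * C)).
  apply: (mintegral_variation hausG lcG haarP) => //.
  - by apply: CuB; exact: Cu_flip.
  - by rewrite ltW.
  - move=> s _; apply/ltW/hU; by rewrite opprD addrACA subrr addr0.
by rewrite mulrAC ltr_pdivrMr ?ltr_wpDl// ltr_pM2l// ltrDl.
Qed.

(** On each cell the integrand is replaced by a sampled value, at a cost of [d] times the [total] of
    the cell. On an empty cell [xget] falls back to [0], and the mass vanishes. *)
Lemma mintegral_riemann mu D E n h (d : R) : bm D -> precompact D ->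
  partitions D E n -> Cu h ->
  (forall i x y, E i x -> E i y -> cmod (h x - h y) <= d) ->
  cmod (mintegral mu D h - \sum_(i < n) h (xget 0 (E i)) * mass mu (E i)) <=
    d * total mu D.
Proof.
move=> mD pD PE ch hd; have [mE ED tE _] := PE.
have pE i : precompact (E i) by exact: precompact_subset pD.
have mint_add : forall A B, bm A -> bm B -> precompact A -> precompact B ->
    A `&` B = set0 -> mintegral mu (A `|` B) h = mintegral mu A h + mintegral mu B h.
  by move=> *; exact: mintegral_setU.
rewrite (additive_cells (mintegral_set0 mu h) mint_add pD PE).
rewrite (additive_cells (total_set0 mu) (total_setU hausG mu) pD PE).
rewrite -sumrB mulr_sumr (le_trans (cmod_sum _ _ _))// ler_sum// => i _.
rewrite -mintegral_cst// -mintegralB//; last exact: Cu_cst.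
apply: mintegral_total => //; first by apply: CuB => //; exact: Cu_cst.
by move=> x Ex; apply: (hd i) => //; exact: xgetI Ex.
Qed.

(** Both iterated integrals are close to the same Riemann sum [J] over a partition of [D], since
    integrating a finite sum against [nu] is exact; uniform continuity of [phi] controls the two
    errors. *)
Lemma mintegral_swap mu nu D (E : set G) phi : bm D -> bm E -> precompact D ->
  precompact E -> Cu phi ->
  mintegral mu D (fun s => mintegral nu E (fun t => phi (s + t))) =
  mintegral nu E (fun t => mintegral mu D (fun s => phi (s + t))).
Proof.
move=> mD mE pD pE cphi; apply/eqP; rewrite -subr_eq0.
set z := _ - _; suff : cmod z <= 0.
  rewrite le_eqVlt ltNge cmod_ge0 orbF => /eqP z0.
  by rewrite -normr_eq0 normcE_cmod z0.
apply/ler_addgt0Pr => e e0; rewrite add0r.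
have tD := total_ge0 mu D; have tE := total_ge0 nu E.
pose T := total mu D * total nu E; have T0 : 0 <= T by rewrite mulr_ge0.
(* Each of the two comparisons with [J] costs at most [d * T]. *)
pose d := e / (2 * T + 1); have d0 : 0 < d by rewrite divr_gt0// ltr_wpDl// mulr_ge0.
have /CuP[_ /(_ _ d0)[U U0 hU]] := cphi.
have [n [F [PF FU]]] := small_cells hausG lcG haarP pD mD U0.
pose y i := xget 0 (F i).
pose H s := mintegral nu E (fun t => phi (s + t)).
pose J := \sum_(i < n) H (y i) * mass mu (F i).
have c1 s : Cu (fun t => phi (s + t)) by exact: Cu_addl.
have c2 t : Cu (fun s => phi (s + t)).
  by under [X in Cu X]funext do rewrite addrC; exact: Cu_addl.
have h1 : cmod (mintegral mu D H - J) <= (d * total nu E) * total mu D.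
  apply: mintegral_riemann => //; first exact: Cu_mintegral.
  move=> i a b Fa Fb; rewrite /H -mintegralB//.
  apply: mintegral_total => //; first exact: CuB.
  move=> t _; apply/ltW/hU; rewrite opprD addrACA subrr addr0; exact: (FU i).
have h2 : cmod (mintegral nu E (fun t => mintegral mu D (fun s => phi (s + t))) - J)
    <= (d * total mu D) * total nu E.
  have -> : J = mintegral nu E (fun t => \sum_(i < n) mass mu (F i) * phi (y i + t)).
    rewrite mintegral_sum//; last by move=> i; exact: CuZ.
    by apply: eq_bigr => i _; rewrite mintegralZ// mulrC.
  have c3 : Cu (fun t => mintegral mu D (fun s => phi (s + t))).
    under [X in Cu X]funext => t.
      under eq_fun do rewrite addrC.
      over.
    exact: Cu_mintegral.
  have c4 : Cu (fun t => \sum_(i < n) mass mu (F i) * phi (y i + t)).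
    by apply: Cu_sum => i; exact: CuZ.
  rewrite -mintegralB//; apply: mintegral_total => //; first exact: CuB.
  move=> t _; under [X in cmod (_ - X)]eq_bigr do rewrite mulrC.
  apply: (@mintegral_riemann mu D F n (fun s => phi (s + t))) => //.
  move=> i a b Fa Fb; apply/ltW/hU; rewrite opprD addrACA subrr addr0.
  exact: (FU i).
have -> : z = (mintegral mu D H - J) -
   (mintegral nu E (fun t => mintegral mu D (fun s => phi (s + t))) - J).
  by rewrite opprB addrA subrK.
rewrite (le_trans (cmodD _ _))// cmodN (le_trans (lerD h1 h2))//.
have -> : d * total nu E * total mu D + d * total mu D * total nu E = d * (2 * T).
  by rewrite /T; ring.
by rewrite /d mulrAC ler_pdivrMr ?ltr_wpDl ?mulr_ge0// ler_pM2l// lerDl.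
Qed.

End convolution.

(** * Means along van Hove sequences *)

Section haar_means.
Variables (R : realType) (G : topologicalZmodType).
Hypotheses (hausG : hausdorff_space G) (lcG : locally_compact [set: G]).
Variable haar : {measure set (borel G) -> \bar R}.
Hypothesis haarP : is_haar haar.
Implicit Types (mu nu : complex_radon G R) (B D : set G).
Implicit Types (h f g phi : G -> R[i]) (A : nat -> set G).
Local Notation bm A := (@measurable _ (borel G) A).
Local Notation vol := (vol haar).

Let haar_radon : radon haar. Proof. by case: haarP. Qed.

Definition absint h B : R := (\int[haar]_(x in B) (cmod (h x)))%R.

Lemma cmod_integrable h B : Cu h -> bm B -> precompact B ->
  haar.-integrable B (EFin \o (fun x : borel G => cmod (h x))).
Proof.
move=> ch mB pB; apply: (bounded_integrable hausG haar_radon) => //.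
  exact: Cu_cmod_measurable.
have [M _ hM] := Cu_bound ch; exists M => x.
by rewrite ger0_norm ?cmod_ge0.
Qed.

Lemma absintE h B : Cu h -> bm B -> precompact B ->
  (\int[haar]_(x in B) (cmod (h x))%:E)%E = (absint h B)%:E.
Proof.
by move=> ch mB pB; rewrite /absint /Rintegral fineK//; exact/integrable_fin_num/cmod_integrable.
Qed.

Lemma absint_ge0 h B : 0 <= absint h B.
Proof. by apply: Rintegral_ge0 => x _; exact: cmod_ge0. Qed.

Lemma absint_le h (M : R) B : Cu h -> bm B -> precompact B ->
  (forall x, cmod (h x) <= M) -> absint h B <= M * vol B.
Proof.
move=> ch mB pB hM; rewrite /vol -(Rintegral_cst _ mB).
apply: le_Rintegral => //; first exact: cmod_integrable.
apply: (bounded_integrable hausG haar_radon) => //.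
by exists `|M|.
Qed.

Lemma absint_ge h (c : R) B : Cu h -> bm B -> precompact B ->
  (forall x, B x -> c <= cmod (h x)) -> c * vol B <= absint h B.
Proof.
move=> ch mB pB hM; rewrite /vol -(Rintegral_cst _ mB).
apply: le_Rintegral => //; last exact: cmod_integrable.
apply: (bounded_integrable hausG haar_radon) => //.
by exists `|c|.
Qed.

Let mcmod h (X : set G) : Cu h ->
  measurable_fun (X : set (borel G)) (EFin \o (fun x : borel G => cmod (h x))).
Proof.
move=> ch; apply/measurable_EFinP.
by apply: measurable_funS (Cu_cmod_measurable ch).
Qed.

Lemma absint_split h B D : Cu h -> bm B -> bm D ->
  (\int[haar]_(x in B) (cmod (h x))%:E =
   \int[haar]_(x in B `\` D) (cmod (h x))%:E +
   \int[haar]_(x in B `&` D) (cmod (h x))%:E)%E.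
Proof.
move=> ch mB mD; rewrite -ge0_integral_setU.
- by rewrite setUC setUIDK.
- exact: measurableD.
- exact: measurableI.
- exact: mcmod.
- by move=> x _; rewrite lee_fin cmod_ge0.
- by apply/disj_setPS => x [[_ nD] [_ Dx]].
Qed.

Lemma absint_subset h B D : Cu h -> bm B -> bm D -> B `<=` D ->
  (\int[haar]_(x in B) (cmod (h x))%:E <= \int[haar]_(x in D) (cmod (h x))%:E)%E.
Proof.
move=> ch mB mD BD; apply: ge0_subset_integral => //; first exact: mcmod.
by move=> x _; rewrite lee_fin cmod_ge0.
Qed.

Lemma absint_setU h (M : R) B D S : Cu h -> bm B -> bm D -> bm S ->
  precompact D -> precompact S -> (forall x, cmod (h x) <= M) ->
  B `<=` D `|` S -> absint h B <= absint h D + M * vol S.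
Proof.
move=> ch mB mD mS pD pS hM BDS.
apply: (@le_trans _ _ (absint h D + absint h S)); last first.
  by rewrite lerD2l absint_le.
have mU : bm (D `|` S) by exact: measurableU.
have pB : precompact B by exact: precompact_subset (precompactU pD pS).
rewrite -lee_fin EFinD -!absintE//.
apply: (le_trans (absint_subset ch mB mU BDS)).
rewrite (absint_split ch mU mD) addeC leeD//.
  by apply: absint_subset => //; exact: measurableI.
apply: absint_subset => //; first exact: measurableD.
by move=> x [[]].
Qed.

Lemma packed_absint h V s u B : Cu h -> sym_nbhd V -> packed V s ->
  bm B -> precompact B -> (forall y v, y \in s -> V v -> B (u + y + v)) ->
  \sum_(y <- s) absint h [set x | V (- (u + y) + x)] <= absint h B.
Proof.
move=> ch [oV _ _ pV] ps mB pB sB.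
have mS y : bm [set x | V (- (u + y) + x)].
  by apply: bm_addl; exact: bm_open.
rewrite -lee_fin -absintE// -sumEFin.
have := @packed_superadditive G R
  (fun B => \int[haar]_(x in B) (cmod (h x))%:E)%E V s u _ _ oV ps B mB sB.
rewrite [X in (_ -> _ -> (X <= _)%E) -> _](_ : _ =
  \sum_(y <- s) (absint h [set x | V (- (u + y) + x)%R])%:E)%E.
  apply.
  - by move=> X _; apply: integral_ge0 => x _; rewrite lee_fin cmod_ge0.
  - by move=> X Y mX mY; exact: absint_split.
rewrite !big_seq; apply: eq_bigr => y ys; rewrite absintE//.
apply: (@precompact_subset _ _ B) => // x /= Vx.
by have := sB y _ ys Vx; rewrite addNKr.
Qed.

(** Change of variables along [x |-> - r + x], under which Haar measure is its own pushforward. *)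
Lemma absint_translate h r B : Cu h -> bm B ->
  absint (translate r h) B = absint h [set x | B (r + x)].
Proof.
move=> ch mB; rewrite /absint /Rintegral; congr fine.
pose f (x : borel G) : borel G := - r + x.
have mf : measurable_fun (setT : set (borel G)) f.
  move=> _ X mX; rewrite setTI; exact: (@bm_addl G (- r) X mX).
have -> : (\int[haar]_(x in [set x | B (r + x)%R]) (cmod (h x))%:E =
   \int[pushforward haar f]_(x in [set x | B (r + x)%R]) (cmod (h x))%:E)%E.
  apply: eq_measure_integral => X mX _.
  by rewrite /pushforward; apply/esym/(haar_addl haarP).
rewrite [RHS]ge0_integral_pushforward//.
- have -> : f @^-1` [set x | B (r + x)] = B.
    by apply/seteqP; split => x; rewrite /f /= addNKr.
  by apply: eq_integral => x _ /=; rewrite /translate /f addrC.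
- exact: bm_addl.
- exact: mcmod.
- by move=> x _; rewrite lee_fin cmod_ge0.
Qed.

(** The upper limit is an infimum of suprema over sets of the filter, and a strict bound already
    holds for one of these sets. *)
Lemma bnorm_near f A (e : R) : mean_vH haar A -> Cu f -> (bnorm haar A f < e%:E)%E ->
  \forall n \near \oo, absint f (A n) <= e * vol (A n).
Proof.
move=> [hA _] cf /ereal_inf_lt[_ [X Xoo <-]] lte; apply: filterS Xoo => n Xn.
have [oA pA A0] := hA n.
rewrite mulrC -ler_pdivrMl// -lee_fin EFinM -absintE//; last exact: bm_open.
by apply: le_trans (ltW lte); apply: ereal_sup_ubound; exists n.
Qed.

(** An eventual real inequality in place of an upper limit in [\bar R]: it combines with other
    eventual estimates by intersecting filter sets. *)
Definition mean_le A h (a : R) : Prop :=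
  \forall n \near \oo, absint h (A n) <= a * vol (A n).

(** Translating [h] amounts to shifting [A n], which adds at most a boundary; the gap between [a]
    and [b] pays for the boundary. *)
Lemma mean_le_translate A h (a b : R) r : mean_vH haar A -> Cu h -> a < b ->
  mean_le A h a -> mean_le A (translate r h) b.
Proof.
move=> [hA vA] ch ab ha; have [M M0 hM] := Cu_bound ch.
pose L : set G := [set 0] `|` [set r].
have cL : compact L by apply: compactU; exact: compact_set1.
have e0 : 0 < (b - a) / (M + 1) by rewrite divr_gt0 ?subr_gt0// ltr_wpDl.
have hb := vA _ cL _ e0; near=> n.
have [oA pA A0] := hA n.
have h1 : absint h (A n) <= a * vol (A n) by near: n.
have h2 : vol (bdry L (A n)) <= (b - a) / (M + 1) * vol (A n) by near: n.
rewrite absint_translate//; last exact: bm_open.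
apply: (@le_trans _ _ (absint h (A n) + M * vol (bdry L (A n)))).
  apply: absint_setU => //.
  - by apply: bm_addl; exact: bm_open.
  - exact: bm_open.
  - exact: bm_bdry.
  - exact: precompact_bdry.
  - move=> x /=; rewrite addrC => Ax.
    by apply: (sumset_bdry _ _ Ax); [left|right].
have h3 : M * vol (bdry L (A n)) <= (b - a) * vol (A n).
  apply: (@le_trans _ _ ((M + 1) * vol (bdry L (A n)))).
    by rewrite ler_wpM2r ?vol_ge0// lerDl.
  apply: (le_trans (ler_wpM2l _ h2)); first by rewrite addr_ge0.
  by rewrite mulrA [(M + 1) * _]mulrC divfK// gt_eqF// ltr_wpDl.
by rewrite (le_trans (lerD h1 h3))// -mulrDl addrC subrK.
Unshelve. all: by end_near. Qed.

Lemma mean_leD A f g h (a b : R) : mean_vH haar A -> Cu f -> Cu g -> Cu h ->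
  (forall x, cmod (h x) <= cmod (f x) + cmod (g x)) ->
  mean_le A f a -> mean_le A g b -> mean_le A h (a + b).
Proof.
move=> [hA vA] cf cg ch hfg ha hb; near=> n.
have [oA pA A0] := hA n; have mA : bm (A n) by exact: bm_open.
have h1 : absint f (A n) <= a * vol (A n) by near: n.
have h2 : absint g (A n) <= b * vol (A n) by near: n.
rewrite mulrDl; apply: le_trans (lerD h1 h2).
rewrite /absint -RintegralD//; last 2 first.
- exact: cmod_integrable.
- exact: cmod_integrable.
apply: le_Rintegral => //; first exact: cmod_integrable.
rewrite (_ : EFin \o _ = (fun x : borel G => (cmod (f x))%:E + (cmod (g x))%:E)%E)//.
by apply: integrableD => //; exact: cmod_integrable.
Unshelve. all: by end_near. Qed.

End haar_means.

(** * From Haar means to means against a translation bounded measure *)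

Section key_estimates.
Variables (R : realType) (G : topologicalZmodType).
Hypotheses (hausG : hausdorff_space G) (lcG : locally_compact [set: G]).
Variable haar : {measure set (borel G) -> \bar R}.
Hypothesis haarP : is_haar haar.
Implicit Types (mu nu : complex_radon G R) (B D : set G) (E : nat -> set G).
Implicit Types (h f g phi : G -> R[i]) (A : nat -> set G).
Local Notation bm A := (@measurable _ (borel G) A).
Local Notation vol := (vol haar).
Local Notation absint := (absint haar).

Lemma partitions_opp D E n : partitions D E n ->
  partitions (oppset D) (fun i => oppset (E i)) n.
Proof.
move=> [mE ED tE DE]; split.
- by move=> i; exact: bm_oppset.
- by move=> i x; rewrite !oppsetE; exact: ED.
- move=> i j _ _; rewrite !oppsetE => -[x [Ei Ej]]; apply: tE => //.
  by exists (- x).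
- rewrite oppsetE; apply/seteqP; split=> x /=.
    rewrite {1}DE => -[i ilt Ei]; exists i => //; by rewrite oppsetE.
  by move=> [i ilt]; rewrite oppsetE => /ED.
Qed.

Lemma fat_opp V (x : G) : (forall x, V x -> V (- x)) -> fat V V x -> fat V V (- x).
Proof.
move=> VN [v Vv Vxv]; exists (- v); first exact: VN.
by rewrite -opprD; exact: VN.
Qed.

(** Each cell of a packing fits into a translate of [W - W], where the variation is at most [C], and
    there are at most [vol B / vol W] cells. *)
Lemma variation_vol nu W : translation_bounded nu -> sym_nbhd W ->
  exists2 C : R, 0 <= C & forall D B, bm D -> precompact D -> bm B ->
    precompact B -> fat W D `<=` B ->
    (variation_measure nu (oppset D) <= (C * vol B)%:E)%E.
Proof.
move=> tb sW; have [oW W0 WN pW] := sW.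
have [C C0 hC] := tb_precompact tb (precompact_fat hausG pW pW).
have vW := vol_gt0 hausG haarP sW.
exists (C / vol W); first by rewrite divr_ge0// ltW.
move=> D B mD pD mB pB DB.
have [s [E [ps sD PE EV]]] := cells hausG haarP pD mD sW.
have := @variation_cells R G hausG nu _ _ _ (fun=> C) (precompact_oppset pD)
  (bm_oppset mD) (partitions_opp PE).
have vE i : (i < size s)%N -> (variation_measure nu (oppset (E i)) <= C%:E)%E.
  move=> _; apply: (hC (- nth 0 s i)) => x; rewrite oppsetE => /EV /(fat_opp WN).
  by rewrite opprD opprK.
move=> /(_ vE) h; apply: (le_trans h); rewrite lee_fin sumr_const card_ord.
rewrite -mulr_natl mulrAC ler_pdivlMr// mulrC mulrA mulrC ler_wpM2l//.
by rewrite mulrC; exact: (packed_vol hausG haarP sW ps sD mB pB DB).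
Qed.

(* On a cell of [D] attached to [y], [|h (t - u)|] is at most [e] plus the average
   of [|h|] over [t + y + V], and the sets [t + y + V] are disjoint. *)
Lemma mintegral_opp_bound nu D B V h (C e w : R) t : sym_nbhd V ->
  (forall u X, (forall x, X x -> fat V V (x - u)) ->
    (variation_measure nu X <= C%:E)%E) -> 0 <= C ->
  bm D -> precompact D -> (variation_measure nu (oppset D) <= w%:E)%E ->
  Cu h -> 0 <= e ->
  (forall x y a b, fat V V a -> V b -> x - y = a - b -> cmod (h x - h y) <= e) ->
  bm B -> precompact B -> (forall y v, D y -> V v -> B (t + y + v)) ->
  cmod (mintegral nu (oppset D) (fun u => h (t - u))) <=
    e * w + C / vol V * absint h B.
Proof.
move=> sV hC C0 mD pD vD ch e0 hV mB pB DB; have [oV V0 VN pV] := sV.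
have vV := vol_gt0 hausG haarP sV.
have [s [E [ps sD PE EV]]] := cells hausG haarP pD mD sV.
pose P i := [set x | V (- (t + nth 0 s i) + x)].
have mP i : bm (P i) by apply: bm_addl; exact: bm_open.
have volP i : vol (P i) = vol V.
  by rewrite /vol haar_addl//; exact: bm_open.
have pP i : precompact (P i).
  have cS : compact (sumset [set t + nth 0 s i] (closure V)).
    apply: compact_sumset; first exact: compact_set1.
    by move: pV; rewrite precompactE.
  apply: (@precompact_subset _ _ (sumset [set t + nth 0 s i] (closure V))).
    move=> x Px; exists (t + nth 0 s i) => //.
    exists (- (t + nth 0 s i) + x); first exact: subset_closure.
    by rewrite addNKr.
  by rewrite precompact_closed//; exact: compact_closed.
pose b i := (vol V)^-1 * absint h (P i).
have b0 i : 0 <= b i by rewrite mulr_ge0 ?invr_ge0 ?absint_ge0// ltW.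
have hb i x : (i < size s)%N -> oppset (E i) x -> cmod (h (t - x)) <= e + b i.
  move=> _; rewrite oppsetE => /EV Vx.
  (* For every [y] in [P i], [|h (t - x)| - e] is at most [|h y|]; this is averaged over [P i]. *)
  rewrite -lerBlDl /b ler_pdivlMl// mulrC -(volP i).
  apply: absint_ge => // y Vy.
  rewrite lerBlDl; apply: (le_trans (cmod_lerB _ (h y))); rewrite addrC lerD2r.
  apply: (hV _ _ _ _ Vx Vy).
  by rewrite opprD opprK addrA [t + nth _ _ _]addrC addrA subrK [- x + t]addrC.
have vE i : (i < size s)%N -> (variation_measure nu (oppset (E i)) <= C%:E)%E.
  move=> _; apply: (hC (- nth 0 s i)) => x; rewrite oppsetE => /EV /(fat_opp VN).
  by rewrite opprD opprK.
have cth : Cu (fun u => h (t - u)) by exact: Cu_flip.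
have := mintegral_cells hausG lcG haarP (bm_oppset mD) (precompact_oppset pD)
  (partitions_opp PE) cth e0 b0 hb vD vE.
move=> hle; apply: (le_trans hle); rewrite lerD2l -mulr_suml -mulr_sumr.
rewrite mulrC mulrA ler_wpM2l//; first by rewrite divr_ge0// ltW.
have := packed_absint hausG haarP (u := t) ch sV ps mB pB.
move=> /(_ (fun y v ys Vv => DB y v (sD y ys) Vv)).
by rewrite (big_nth 0) big_mkord.
Qed.

(** The order of quantifiers is the point: [C1] comes from a fixed auxiliary [W], whereas [C2]
    depends on [U] and may grow as [U] shrinks. Neither depends on [t], which only influences how
    large [n] must be. *)
Lemma mean_bound nu A : translation_bounded nu -> mean_vH haar A ->
  exists2 C1 : R, 0 <= C1 & forall U : set G, nbhs (0 : G) U ->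
  exists2 C2 : R, 0 <= C2 & forall h (e a eta : R) t, Cu h -> 0 <= e ->
    (forall x y, U (x - y) -> cmod (h x - h y) <= e) ->
    mean_le haar A h a -> 0 < eta ->
    \forall n \near \oo,
      cmod (mintegral nu (oppset (A n)) (fun u => h (t - u))) <=
        (C1 * e + C2 * a + eta) * vol (A n).
Proof.
move=> tb [hA vA].
have [W sW _] := exists_sym_nbhd lcG (filterT : nbhs (0 : G) setT).
have [oW W0 WN pW] := sW.
have [C C0 hC] := variation_vol tb sW.
exists (C * 2); first by rewrite mulr_ge0.
move=> U /(exists_sym_nbhd lcG)[V sV VU]; have [oV V0 VN pV] := sV.
have [CV CV0 hCV] := tb_precompact tb (precompact_fat hausG pV pV).
have vV := vol_gt0 hausG haarP sV.
have C20 : 0 <= CV / vol V by rewrite divr_ge0// ltW.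
exists (CV / vol V) => // h e a eta t ch e0 hU ha eta0.
have [M M0 hM] := Cu_bound ch.
have cW : compact (closure W) by move: pW; rewrite precompactE.
have cV : compact (closure V) by move: pV; rewrite precompactE.
(* Chosen so that [t + A n + V] lies in [A n] together with [bdry L (A n)]; the contribution of this
   boundary is what [eta] absorbs. *)
pose L : set G := [set 0] `|` sumset [set - t] (closure V).
have cL : compact L.
  apply: compactU; first exact: compact_set1.
  by apply: compact_sumset => //; exact: compact_set1.
have h1 := vA _ cW _ ltr01.
have eta1 : 0 < eta / (CV / vol V * M + 1).
  by rewrite divr_gt0// ltr_wpDl// mulr_ge0.
have h2 := vA _ cL _ eta1.
near=> n; have [oA pA A0] := hA n; have mA : bm (A n) by exact: bm_open.
have h1n : vol (bdry (closure W) (A n)) <= 1 * vol (A n) by near: n.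
have h2n : vol (bdry L (A n)) <= eta / (CV / vol V * M + 1) * vol (A n) by near: n.
have h3n : absint h (A n) <= a * vol (A n) by near: n.
have mBW : bm (bdry (closure W) (A n)) by exact: bm_bdry.
have pBW := precompact_bdry hausG cW pA.
have mBL : bm (bdry L (A n)) by exact: bm_bdry.
have pBL := precompact_bdry hausG cL pA.
have vD := hC _ _ mA pA (measurableU _ _ mA mBW) (precompactU pA pBW) (fat_bdry W0).
have hV x y p q : fat V V p -> V q -> x - y = p - q -> cmod (h x - h y) <= e.
  move=> Vp Vq xy; apply: hU; rewrite xy; apply: VU => //.
  by exists (- q); [exact: VN|rewrite subrr].
have DB y v : A n y -> V v -> (A n `|` bdry L (A n)) (t + y + v).
  move=> Ay Vv; apply: (@sumset_bdry _ L _ _ (- t - v)); first by left.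
    right; exists (- t) => //; exists (- v) => //; exact/subset_closure/VN.
  by rewrite -opprD [t + y]addrC -(addrA y) addrK.
have := mintegral_opp_bound sV hCV CV0 mA pA vD ch e0 hV
  (measurableU _ _ mA mBL) (precompactU pA pBL) DB.
move=> hle; apply: (le_trans hle).
have k1 : C * vol (A n `|` bdry (closure W) (A n)) <= C * 2 * vol (A n).
  rewrite -mulrA ler_wpM2l// (le_trans (vol_setU hausG haarP mA mBW pA pBW))//.
  by rewrite mulrDl mul1r lerD2l -[leRHS]mul1r.
have k2 : absint h (A n `|` bdry L (A n)) <= absint h (A n) + M * vol (bdry L (A n)).
  by apply: absint_setU => //; exact: measurableU.
have k3 : CV / vol V * (M * vol (bdry L (A n))) <= eta * vol (A n).
  rewrite mulrA; apply: (@le_trans _ _ ((CV / vol V * M + 1) * vol (bdry L (A n)))).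
    by rewrite ler_wpM2r ?vol_ge0// lerDl.
  have p0 : 0 < CV / vol V * M + 1 by rewrite ltr_wpDl// mulr_ge0.
  apply: (le_trans (ler_wpM2l (ltW p0) h2n)).
  by rewrite mulrA [(_ + 1) * _]mulrC divfK// gt_eqF.
apply: (le_trans (lerD (ler_wpM2l e0 k1) (ler_wpM2l C20 k2))).
have k4 := ler_wpM2l C20 h3n; move: k3 k4.
move: (absint h _) (vol (bdry _ _)) (CV / vol V) => x y z k3 k4; lra.
Unshelve. all: by end_near. Qed.

(* The inner integrals differ only if [- u] lies in a boundary of [A n]. *)
Lemma restrict_inner mu nu A phi t (eta : R) :
  translation_bounded mu -> translation_bounded nu -> mean_vH haar A -> Cc phi ->
  0 < eta -> \forall n \near \oo,
    cmod (mintegral nu (oppset (A n)) (fun u => convolution mu phi (t - u)) -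
      mintegral nu (oppset (A n))
        (fun u => mintegral mu (A n) (fun s => phi (t - u - s)))) <=
    eta * vol (A n).
Proof.
move=> tbm tbn [hA vA] cphi eta0; have cuphi := Cc_Cu cphi.
have [M M0 phiM] := Cu_bound cuphi.
pose K := closure [set x | phi x != 0].
have KP x : ~ K x -> phi x = 0.
  move=> nK; apply/eqP; apply/negP => /negP x0; apply: nK.
  by apply: subset_closure.
have cK : compact K by case: cphi.
have cf := Cu_convolution hausG lcG haarP tbm cphi.
have [F F0 hF] := Cu_bound cf.
have cOK : compact (oppset K) by exact: compact_oppset.
have pOK : precompact (oppset K) by rewrite precompact_closed//; exact: compact_closed.
have [C C0 hC] := tb_precompact tbm pOK.
have [W sW _] := exists_sym_nbhd lcG (filterT : nbhs (0 : G) setT).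
have [oW W0 WN pW] := sW.
have cW : compact (closure W) by move: pW; rewrite precompactE.
have [CW CW0 hCW] := variation_vol tbn sW.
(* At a point [- u] of [A n], the element [0] witnesses membership, and [t - K] provides the witness
   outside [A n] whenever truncation removes a point where [phi (t - u - s)] is nonzero. *)
pose L : set G := [set 0] `|` sumset [set t] (oppset K).
have cL : compact L.
  apply: compactU; first exact: compact_set1.
  by apply: compact_sumset => //; exact: compact_set1.
(* Room for the thickening that [variation_vol] requires. *)
pose L' := sumset L (oppset (closure W)).
have cL' : compact L' by apply: compact_sumset => //; exact: compact_oppset.
pose b := F + M * C; have b0 : 0 <= b by rewrite addr_ge0// mulr_ge0.
have eta1 : 0 < eta / (b * CW + 1) by rewrite divr_gt0// ltr_wpDl// mulr_ge0.
have := vA _ cL' _ eta1; apply: filterS => n h1n.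
have [oA pA A0] := hA n; have mA : bm (A n) by exact: bm_open.
pose d u := convolution mu phi (t - u) -
  mintegral mu (A n) (fun s => phi (t - u - s)).
have cin : Cu (fun u => mintegral mu (A n) (fun s => phi (t - u - s))).
  have c1 : Cu (fun x => mintegral mu (A n) (fun s => phi (- (x + s)))).
    apply: (Cu_mintegral hausG mu mA pA (phi := fun x => phi (- x))).
    exact: Cu_opp.
  have := Cu_addl (- t) c1; congr Cu; apply/funext => u; congr mintegral.
  by apply/funext => s; rewrite !opprD opprK.
have cd : Cu d by apply: CuB => //; exact: Cu_flip.
rewrite -mintegralB//; last 3 first.
- exact: bm_oppset.
- exact: precompact_oppset.
- exact: Cu_flip.
rewrite -/d.
(* Only [s] in the translate [t - u - K] contribute to the inner integral, so the bound depends on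
   neither [n] nor [u]. *)
have db u : cmod (d u) <= b.
  rewrite (le_trans (cmodD _ _))// cmodN lerD//.
  pose D := [set s | oppset K (- (t - u) + s)].
  have mD : bm D by apply: bm_addl; exact: bm_compact.
  have cg : Cu (fun s => phi (t - u - s)) by exact: Cu_flip.
  have -> : A n = (A n `&` D) `|` (A n `\` D) by rewrite setUIDK.
  have pAD X : precompact (A n `&` X) by apply: precompact_subset pA => x [].
  have ADD : (A n `&` D) `&` (A n `\` D) = set0.
    by apply/seteqP; split => // x [[_ Dx] [_ nD]].
  rewrite (mintegral_setU hausG mu (measurableI _ _ mA mD) (measurableD mA mD)
    (pAD D) (pAD (~` D)) cg ADD).
  have -> : mintegral mu (A n `\` D) (fun s => phi (t - u - s)) = 0.
    apply: mintegral_eq0 => [|s [_ nD]]; first exact: measurableD.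
    apply: KP => Ks; apply: nD; exists (t - u - s) => //.
    by rewrite opprB addrC.
  rewrite addr0; apply: (mintegral_variation hausG lcG haarP) => //.
  - exact: measurableI.
  - by apply: (hC (t - u)) => x [_]; rewrite /D /= addrC.
pose S := bdry L (A n).
have mS : bm S by exact: bm_bdry.
have pI X : precompact (A n `&` X) by apply: precompact_subset pA => x [].
have -> : oppset (A n) = oppset (A n `&` S) `|` oppset (A n `\` S).
  by rewrite !oppsetE -[in LHS](setUIDK (A n) S).
have ASS : oppset (A n `&` S) `&` oppset (A n `\` S) = set0.
  by rewrite !oppsetE; apply/seteqP; split => // x [[_ Dx] [_ nD]].
rewrite (mintegral_setU hausG nu (bm_oppset (measurableI _ _ mA mS))
  (bm_oppset (measurableD mA mS)) (precompact_oppset (pI S))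
  (precompact_oppset (pI (~` S))) cd ASS).
have -> : mintegral nu (oppset (A n `\` S)) d = 0.
  apply: mintegral_eq0 => [|x]; first by apply: bm_oppset; exact: measurableD.
  rewrite oppsetE => -[Ax nS]; rewrite /d.
  have -> : convolution mu phi (t - x) =
      mintegral mu (A n) (fun s => phi (t - x - s)).
    apply: mintegral_support => s nAs; apply: KP => Ks; apply: nS; split.
      by exists 0; [left|rewrite addr0].
    exists (s + x); last by rewrite addrC addrK.
    right; exists t => //; exists (- (t - x - s)); first by exists (t - x - s).
    by rewrite !opprD !opprK !addrA subrr add0r addrC.
  by rewrite subrr.
rewrite addr0.
have vS := hCW (A n `&` S) (bdry L' (A n)) (measurableI _ _ mA mS) (pI S)
  (bm_bdry cL' oA) (precompact_bdry hausG cL' pA).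
have {}vS := vS _.
have k : fat W (A n `&` S) `<=` bdry L' (A n).
  move=> x [w Ww [_ /bdry_add]] /(_ (closure W) (- w)); rewrite addrK; apply.
  exact/subset_closure/WN.
have := mintegral_variation hausG lcG haarP (bm_oppset (measurableI _ _ mA mS))
  (precompact_oppset (pI S)) cd b0 (fun x _ => db x) (vS k).
move=> hle; apply: (le_trans hle); rewrite mulrA.
apply: (@le_trans _ _ ((b * CW + 1) * vol (bdry L' (A n)))).
  by rewrite ler_wpM2r ?vol_ge0// lerDl.
have p0 : 0 < b * CW + 1 by rewrite ltr_wpDl// mulr_ge0.
apply: (le_trans (ler_wpM2l (ltW p0) h1n)).
by rewrite mulrA [(_ + 1) * _]mulrC divfK// gt_eqF.
Qed.

End key_estimates.

(** * Almost periodicity of the limit *)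

Section bohr_compactness.
Variables (R : realType) (G : topologicalZmodType).
Implicit Types (F p g : G -> R[i]).

Lemma nbhs_uniformP F (P : set {uniform G -> R[i]}) :
  nbhs (F : {uniform G -> R[i]}) P <->
  exists2 e : R, 0 < e & forall g : G -> R[i], (forall x, cmod (F x - g x) < e) -> P g.
Proof.
split.
  move=> /uniform_nbhs[E [entE EP]].
  move: entE; rewrite -entourage_ballE => -[e /= e0 eE].
  have /andP[/eqP ime rep] : (complex.Im e == complex.Im (0 : R[i])) && (0 < complex.Re e).
    by rewrite -[X in _ && (X < _)]/(complex.Re (0 : R[i])) -ltcE.
  exists (complex.Re e) => // g hg; apply: EP => x _ /=; apply: eE => /=.
  rewrite /ball/= normcE_cmod.
  by rewrite ltcE /= ime eqxx hg.
move=> [e e0 eP]; apply/uniform_nbhs.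
exists [set xy | ball xy.1 (e%:C)%C xy.2]; split.
  rewrite -entourage_ballE; exists (e%:C)%C => //=.
  by rewrite ltcR.
move=> g hg; apply: eP => x; have := hg x I.
by rewrite /= /ball/= normcE_cmod ltcR.
Qed.

(** An ultrafilter on the closed orbit contains balls of every radius. Its limit is assembled from
    pointwise cluster values, and the small balls upgrade this to uniform convergence. *)
Lemma bohr_strongly_ap F : Cu F ->
  (forall e : R, 0 < e ->
    relatively_dense [set r | forall t, cmod (F t - F (t - r)) <= e]) ->
  strongly_ap_fun F.
Proof.
move=> cF hF; split=> //.
set S := (X in compact X).
rewrite compact_ultra => Fl UF FlS.
have PF : ProperFilter Fl by exact: ultra_proper.
have /CuP[[M FM] Fu] := cF.
have closeS g e : S g -> 0 < e -> exists t, forall x, cmod (g x - translate t F x) < e.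
  move=> [_ clg] e0.
  have : nbhs (g : {uniform G -> R[i]}) [set g' : {uniform G -> R[i]} |
      forall x, cmod (g x - g' x) < e].
    by apply/nbhs_uniformP; exists e.
  by move=> /clg[_ [[t _ <-] ht]]; exists t.
(* The orbit is totally bounded, so the ultrafilter contains small balls. *)
have small (e : R) : 0 < e -> exists g0 : G -> R[i],
    Fl [set g | forall x, cmod (g0 x - g x) <= e *+ 3].
  move=> e0; have [K cK PK] := hF _ e0.
  apply: contrapT => nsmall.
  have nB k : Fl (~` [set g | forall x, cmod (translate k F x - g x) <= e *+ 3]).
    have [h|//] := @in_ultra_setVsetC _ _
      [set g | forall x, cmod (translate k F x - g x) <= e *+ 3] UF.
    by exfalso; apply: nsmall; exists (translate k F).
  (* Moving from [k] to a nearby [k'] uses one of the three [e]. The other two are spent on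
     approximating [g] by a translate of [F], and on replacing that translate by one with parameter
     in [K] through an almost period. *)
  have : \forall g \near Fl, K `<=`
      [set k | ~ forall x, cmod (translate k F x - g x) <= e *+ 2].
    move/compact_near_coveringP : cK; apply => k _.
    have [U U0 hU] := Fu _ e0.
    exists ([set k' | U (k' - k)],
      ~` [set g | forall x, cmod (translate k F x - g x) <= e *+ 3]).
      by split; [exact: nbhs_subr|exact: nB].
    move=> [k' g] /= [Uk ng] h; apply: ng => x.
    rewrite -[X in X - _](subrK (translate k' F x)) -addrA.
    rewrite (le_trans (cmodD _ _))// mulrS lerD//.
    by rewrite /translate ltW// hU// opprB addrC addrA subrK.
  move=> hK; have [g [Sg gK]] := filter_ex (filterI FlS hK).
  have [t gt] := closeS _ _ Sg e0.
  have [q /= hq [k Kk qkt]] : sumset [set r | forall t, cmod (F t - F (t - r)) <= e] K t.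
    by rewrite PK.
  apply: (gK k Kk) => x; rewrite cmodB.
  rewrite -[X in X - _](subrK (translate t F x)) -addrA.
  rewrite (le_trans (cmodD _ _))// mulrS lerD ?(ltW (gt x))//.
  rewrite cmodB /translate -qkt [q + k]addrC opprD addrA; exact: hq.
have closeM g x : S g -> cmod (g x) <= M + 1.
  move=> Sg; have [t ht] := closeS _ _ Sg ltr01.
  rewrite (le_trans (cmod_lerB _ (translate t F x)))// lerD//; first exact: FM.
  exact: ltW.
have [Kd cKd hKd] := @compact_disc R (M + 1).
have plim x : exists z, cluster ((fun g : {uniform G -> R[i]} => g x : R[i]) @ Fl) z.
  have : ((fun g : {uniform G -> R[i]} => g x : R[i]) @ Fl) Kd.
    have : Fl [set g : {uniform G -> R[i]} | Kd (g x)].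
      by apply: filterS FlS => g Sg; apply: hKd; exact: (closeM g x Sg).
    by [].
  by move=> /cKd[z [_ clz]]; exists z.
have [p hp] := choice plim.
have cvgp (e : R) : 0 < e -> Fl [set g | forall x, cmod (p x - g x) < e].
  (* One eighth for the cluster value and three eighths for each of two distances to [g0] leave the
     sum below [e]. *)
  move=> e0; have e8 : 0 < e / 8 by rewrite divr_gt0.
  have [g0 hg0] := small _ e8.
  apply: filterS (hg0) => g gg0 x.
  have nz : nbhs (p x) [set z : R[i] | cmod (p x - z) < e / 8].
    have := (@cvg_cmodP R R[i] (nbhs (p x)) _ id (p x)).1 (@cvg_id _ _).
    exact.
  have hx : ((fun g : {uniform G -> R[i]} => g x : R[i]) @ Fl)
      [set z | exists g' : G -> R[i],
        (forall x, cmod (g0 x - g' x) <= e / 8 *+ 3) /\ g' x = z].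
    have : Fl [set g : {uniform G -> R[i]} | exists g' : G -> R[i],
        (forall x, cmod (g0 x - g' x) <= e / 8 *+ 3) /\ g' x = g x].
      by apply: filterS (hg0) => g' ?; exists g'.
    by [].
  have [_ [[g' [gg' <-]] pg']] := hp x _ _ hx nz.
  have h1 := gg0 x; have h2 := gg' x; have h3 : cmod (p x - g' x) < e / 8 by [].
  have -> : p x - g x = (p x - g' x) + ((g' x - g0 x) + (g0 x - g x)) by ring.
  rewrite (le_lt_trans (cmodD _ _))//.
  have h4 := cmodD (g' x - g0 x) (g0 x - g x); rewrite (cmodB (g' x)) in h4.
  rewrite -mulr_natr in h1 h2; lra.
have Flp : Fl --> (p : {uniform G -> R[i]}).
  by move=> P /nbhs_uniformP[e e0 eP]; apply: filterS (cvgp e e0) => g; exact: eP.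
have near_p (e : R) : 0 < e -> exists g, S g /\ forall x, cmod (p x - g x) < e.
  move=> e0; have [g [Sg pg]] := filter_ex (filterI FlS (cvgp e e0)).
  by exists g.
exists p; split=> //; split.
  apply/CuP; split.
    have [g [Sg pg]] := near_p 1 ltr01; exists (M + 1 + 1) => x.
    by rewrite (le_trans (cmod_lerB _ (g x)))// lerD ?closeM ?ltW.
  move=> e e0; have e3 : 0 < e / 3 by rewrite divr_gt0.
  have [g [[/CuP[_ gu] _] pg]] := near_p _ e3.
  have [U U0 hU] := gu _ e3; exists U => // x y /hU gxy.
  have -> : p x - p y = (p x - g x) + ((g x - g y) + (g y - p y)) by ring.
  have h4 := cmodD (g x - g y) (g y - p y); rewrite (cmodB (g y)) in h4.
  have h1 := pg x; have h2 := pg y; rewrite (le_lt_trans (cmodD _ _))//; lra.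
move=> P /nbhs_uniformP[e e0 eP].
have e2 : 0 < e / 2 by rewrite divr_gt0.
have [g [Sg pg]] := near_p _ e2; have [t gt] := closeS _ _ Sg e2.
exists (translate t F); split; first by exists t.
apply: eP => x.
have -> : p x - translate t F x = (p x - g x) + (g x - translate t F x) by ring.
have h1 := pg x; have h2 := gt x; rewrite (le_lt_trans (cmodD _ _))//; lra.
Qed.

End bohr_compactness.

(** * The limit function inherits boundedness, uniform continuity and almost periods *)

Section almost_periodicity.
Variables (R : realType) (G : topologicalZmodType).
Hypotheses (hausG : hausdorff_space G) (lcG : locally_compact [set: G]).
Variable haar : {measure set (borel G) -> \bar R}.
Hypothesis haarP : is_haar haar.
Variables (A : nat -> set G) (mu nu : complex_radon G R).
Hypotheses (vHA : mean_vH haar A).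
Hypotheses (tbm : translation_bounded mu) (tbn : translation_bounded nu).
(** The normalizing factor is not tied to [A]: (a) uses the inverse volume with [c0 = 1], while (b)
    takes the reflected sequence with the inverse volume of the original one. *)
Variables (c : nat -> R) (c0 : R).
Hypotheses (c_ge0 : forall n, 0 <= c n) (c0_gt0 : 0 < c0).
Hypothesis c_le : \forall n \near \oo, c n * vol haar (A n) <= c0.
Variable phi : G -> R[i].
Hypothesis cphi : Cc phi.
Variable F : G -> R[i].
Hypothesis limF : forall t, (c n)%:C%C * mintegral nu (oppset (A n))
  (fun u => mintegral mu (A n) (fun s => phi (t - u - s))) @[n --> \oo] --> F t.
Local Notation bm A := (@measurable _ (borel G) A).
Local Notation vol := (vol haar).
Local Notation f := (convolution mu phi).

Let cf : Cu f. Proof. exact: (Cu_convolution hausG lcG haarP). Qed.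

(** [restrict_inner] trades the truncated inner integral for the full convolution; after
    normalization the error is below any given bound. *)
Let limit_convolution t (d : R) : 0 < d -> \forall n \near \oo,
  cmod (F t - (c n)%:C%C * mintegral nu (oppset (A n)) (fun u => f (t - u))) < d.
Proof.
move=> d0; have d20 : 0 < d / 2 by rewrite divr_gt0.
have h1 := (@cvg_cmodP R nat \oo eventually_filter _ _).1 (@limF t) _ d20.
have e0 : 0 < d / 2 / (c0 + 1) by rewrite divr_gt0// addr_gt0.
have h2 := restrict_inner hausG lcG haarP t tbm tbn vHA cphi e0.
apply: filterS (filterI h1 (filterI h2 c_le)) => n [h1n [h2n h3n]].
set I := mintegral _ _ _; move: h1n h2n; set J := mintegral _ _ _ => h1n h2n.
have -> : F t - (c n)%:C%C * I = (F t - (c n)%:C%C * J) - (c n)%:C%C * (I - J) by ring.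
rewrite (le_lt_trans (cmodD _ _))// cmodN cmodM cmod_real ger0_norm//.
rewrite [ltRHS]splitr ltr_leD//.
apply: (le_trans (ler_wpM2l (c_ge0 n) h2n)); rewrite mulrCA.
have e1 := ltW e0; apply: (le_trans (ler_wpM2l e1 h3n)).
by rewrite mulrAC ler_pdivrMr ?addr_gt0// ler_wpM2l ?(ltW d20)// lerDl.
Qed.

(** [F (t - r)] is the limit belonging to [translate r f], so the difference is governed by the mean
    of [f - translate r f] against [nu]. A single [n] satisfying all estimates suffices. *)
Let limit_diff t r (k : R) :
  (\forall n \near \oo, cmod (mintegral nu (oppset (A n))
     (fun u => f (t - u) - translate r f (t - u))) <= k * vol (A n)) ->
  0 <= k -> cmod (F t - F (t - r)) <= c0 * k.
Proof.
move=> hk k0; apply/ler_addgt0Pr => d d0; have d20 : 0 < d / 2 by rewrite divr_gt0.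
have h1 := limit_convolution t d20; have h2 := limit_convolution (t - r) d20.
have [n [[h1n h2n] [h3n h4n]]] :=
  filter_ex (filterI (filterI h1 h2) (filterI hk c_le)).
have [oA pA _] := vHA.1 n.
move: h1n h2n h3n.
rewrite mintegralB//; last 4 first.
- by apply: bm_oppset; exact: bm_open.
- exact: precompact_oppset.
- exact: Cu_flip.
- by apply: Cu_flip; exact: Cu_translate.
have -> : (fun u => translate r f (t - u)) = (fun u => f (t - r - u)).
  by apply/funext => u; rewrite /translate addrAC.
set I := mintegral _ _ _; set J := mintegral _ _ _ => h1n h2n h3n.
have -> : F t - F (t - r) = (F t - (c n)%:C%C * I) -
   (F (t - r) - (c n)%:C%C * J) + (c n)%:C%C * (I - J) by ring.
rewrite (le_trans (cmodD _ _))// cmodM cmod_real ger0_norm// addrC lerD//.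
  apply: (le_trans (ler_wpM2l (c_ge0 n) h3n)).
  by rewrite mulrCA [leRHS]mulrC ler_wpM2l.
apply: (le_trans (cmodD _ _)); rewrite cmodN [leRHS]splitr.
by apply: lerD; [exact: (ltW h1n)|exact: (ltW h2n)].
Qed.

Let limit_bounded : exists M : R, forall t, cmod (F t) <= M.
Proof.
have [C1 C10 hC1] := mean_bound hausG lcG haarP tbn vHA.
(* No smallness is sought, so the whole group serves as [U], with the trivial oscillation bound
   [2 * M]. *)
have [C2 C20 hC2] := hC1 setT filterT.
have [M M0 fM] := Cu_bound cf.
pose k := C1 * (2 * M) + C2 * M + 1.
exists (c0 * k + 1) => t.
have h1 := limit_convolution t ltr01.
have h2 : \forall n \near \oo,
    cmod (mintegral nu (oppset (A n)) (fun u => f (t - u))) <= k * vol (A n).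
  apply: (hC2 f) => //; first by rewrite mulr_ge0.
    move=> x y _; rewrite (le_trans (cmodD _ _))// cmodN.
    by rewrite mulrDl mul1r lerD.
  apply: nearW => n; have [oA pA _] := vHA.1 n.
  by apply: absint_le => //; exact: bm_open.
have [n [h1n [h2n h3n]]] := filter_ex (filterI h1 (filterI h2 c_le)).
have k0 : 0 <= k by rewrite !addr_ge0 ?mulr_ge0.
apply: (le_trans (cmod_lerB _ ((c n)%:C%C *
  mintegral nu (oppset (A n)) (fun u => f (t - u))))).
apply: lerD; last exact: (ltW h1n).
rewrite cmodM cmod_real ger0_norm//.
apply: (le_trans (ler_wpM2l (c_ge0 n) h2n)).
by rewrite mulrCA [leRHS]mulrC ler_wpM2l.
Qed.

(** For [x] close to [y], the shift by [r = x - y] moves [f] by at most [d] everywhere. So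
    [f - translate r f] has mean at most [d] and oscillation at most [2 * d], even with
    [U = setT]. *)
Let limit_Cu : Cu F.
Proof.
apply/CuP; split; first exact: limit_bounded.
move=> e e0; have [C1 C10 hC1] := mean_bound hausG lcG haarP tbn vHA.
have [C2 C20 hC2] := hC1 setT filterT.
pose d := e / (2 * c0 * (C1 * 2 + C2 + 1)).
have s0 : 0 < C1 * 2 + C2 + 1 by rewrite ltr_wpDl// addr_ge0// mulr_ge0.
have d0 : 0 < d by rewrite divr_gt0// mulr_gt0// mulr_gt0.
have /CuP[_ /(_ _ d0)[U U0 hU]] := cf.
exists U => // x y Uxy.
have -> : F y = F (x - (x - y)) by rewrite opprB addrC subrK.
apply: (@le_lt_trans _ _ (c0 * (C1 * (2 * d) + C2 * d + d))); last first.
  have -> : C1 * (2 * d) + C2 * d + d = d * (C1 * 2 + C2 + 1) by ring.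
  have -> : c0 * (d * (C1 * 2 + C2 + 1)) = e / 2.
    rewrite /d; field; apply/andP; split; exact: lt0r_neq0.
  by rewrite ltr_pdivrMr// ltr_pMr// ltr1n.
have fd z : cmod (f z - translate (x - y) f z) <= d.
  by apply/ltW/hU; rewrite opprB addrC subrK.
have d0' := ltW d0.
apply: limit_diff; last first.
  by have := mulr_ge0 C10 d0'; have := mulr_ge0 C20 d0'; lra.
have ch : Cu (fun z => f z - translate (x - y) f z).
  by apply: CuB => //; exact: Cu_translate.
apply: (hC2 (fun z => f z - translate (x - y) f z)) => //.
- by rewrite mulr_ge0.
- move=> z w _; rewrite (le_trans (cmodD _ _))// cmodN.
  by rewrite mulrDl mul1r lerD.
- apply: nearW => n; have [oA pA _] := vHA.1 n.
  by apply: absint_le => //; exact: bm_open.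
Qed.

Let limit_almost_periods : Map1 haar A f -> forall e : R, 0 < e ->
  relatively_dense [set r | forall t, cmod (F t - F (t - r)) <= e].
Proof.
move=> [_ fMap] e e0.
have [C1 C10 hC1] := mean_bound hausG lcG haarP tbn vHA.
pose k := e / c0; have k0 : 0 < k by rewrite divr_gt0.
(* Fixed before [U] and [C2] are known. The oscillation of [f - translate r f] is at most [2 * a],
   so its term is at most [k / 3]. *)
pose a := k / (6 * (C1 + 1)).
have C11 : 0 < C1 + 1 by rewrite ltr_wpDl.
have a0 : 0 < a by rewrite divr_gt0// mulr_gt0.
have /CuP[_ /(_ _ a0)[U U0 hU]] := cf.
have [C2 C20 hC2] := hC1 U U0.
have C21 : 0 < C2 + 1 by rewrite ltr_wpDl.
(* The mean of [f - translate r f] is at most [4 * d], so the [C2] term is at most [k / 3]; the last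
   third is [eta]. *)
pose d := k / (12 * (C2 + 1)).
have d0 : 0 < d by rewrite divr_gt0// mulr_gt0.
have [g [cg gap] fg] := fMap _ d0.
have cfg : Cu (fun x => f x - g x) by exact: CuB.
have mfg : mean_le haar A (fun x => f x - g x) d by apply: bnorm_near.
apply: relatively_denseS (gap _ d0) => r /= gr t.
have mg : mean_le haar A (fun x => g x - translate r g x) d.
  apply: bnorm_near => //; apply: CuB => //; exact: Cu_translate.
(* Translation preserves a mean bound only up to a strict loss, hence [2 * d]. *)
have mt : mean_le haar A (translate r (fun x => f x - g x)) (2 * d).
  by apply: mean_le_translate mfg => //; rewrite mulr_natl mulr2n ltrDl.
have cgr : Cu (fun x => g x - translate r g x).
  by apply: CuB => //; exact: Cu_translate.
have cfr : Cu (fun x => f x - translate r f x).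
  by apply: CuB => //; exact: Cu_translate.
have ctr : Cu (translate r (fun x => f x - g x)) by exact: Cu_translate.
have m1 : mean_le haar A (fun x => (f x - g x) + (g x - translate r g x)) (d + d).
  apply: (mean_leD hausG haarP vHA cfg cgr _ _ mfg mg) => //; first exact: CuD.
  by move=> x; exact: cmodD.
have m2 : mean_le haar A (fun x => f x - translate r f x) (d + d + 2 * d).
  apply: (mean_leD hausG haarP vHA (CuD cfg cgr) ctr _ _ m1 mt) => // x.
  rewrite -(cmodN (translate _ _ x)).
  apply: le_trans (cmodD _ _); rewrite le_eqVlt; apply/orP; left; apply/eqP.
  by congr cmod; rewrite /translate; ring.
have -> : e = c0 * k by rewrite /k mulrCA divff ?mulr1// gt_eqF.
apply: limit_diff; last exact: ltW.
have h : \forall n \near \oo,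
    cmod (mintegral nu (oppset (A n)) (fun u => f (t - u) - translate r f (t - u)))
    <= (C1 * (2 * a) + C2 * (d + d + 2 * d) + k / 3) * vol (A n).
  apply: (hC2 (fun z => f z - translate r f z)) => //.
  - by rewrite mulr_ge0// ltW.
  - move=> x y Uxy.
    have -> : f x - translate r f x - (f y - translate r f y) =
      (f x - f y) - (translate r f x - translate r f y) by ring.
    rewrite (le_trans (cmodD _ _))// cmodN mulrDl mul1r lerD//.
      by rewrite ltW// hU.
    by rewrite ltW// hU// opprB addrA addrNK.
  - by rewrite divr_gt0.
apply: filterS h => n hn; apply: (le_trans hn); rewrite ler_wpM2r ?vol_ge0//.
have q1 : C1 * (2 * a) <= k / 3.
  have -> : k / 3 = (C1 + 1) * (2 * a) by rewrite /a; field; rewrite gt_eqF.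
  by apply: ler_wpM2r; rewrite ?lerDl//; apply: mulr_ge0 => //; exact: ltW.
have q2 : C2 * (d + d + 2 * d) <= k / 3.
  have -> : k / 3 = (C2 + 1) * (d + d + 2 * d) by rewrite /d; field; rewrite gt_eqF.
  by apply: ler_wpM2r; rewrite ?lerDl//; lra.
lra.
Qed.

Lemma limit_strongly_ap : Map1 haar A f -> strongly_ap_fun F.
Proof.
move=> fMap; apply: bohr_strongly_ap; first exact: limit_Cu.
exact: limit_almost_periods.
Qed.

End almost_periodicity.

Theorem proposition4p24 (R : realType) (G : topologicalZmodType)
  (hausG : hausdorff_space G)
  (lcG : locally_compact [set: G])
  (scG : @second_countable G)
  (haar : {measure set (borel G) -> \bar R}) (haarP : is_haar haar)
  (A : nat -> set G) (vhA : van_hove haar A)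
  (mu nu : complex_radon G R)
  (tb_mu : translation_bounded mu) (tb_nu : translation_bounded nu)
  (lambda : complex_radon G R) (ebP : is_eberlein haar A mu nu lambda) :
  (mean_ap haar A mu -> strongly_ap lambda) /\
  (mean_ap haar (fun n => oppset (A n)) nu -> strongly_ap lambda).
Proof.
have vH := van_hove_mean hausG haarP vhA.
have oA n : open (A n) by have [] := vH.1 n.
have pA n : precompact (A n) by have [] := vH.1 n.
have c_ge0 n : 0 <= (vol haar (A n))^-1 by rewrite invr_ge0 vol_ge0.
split=> mapP phi cphi.
  have c_le : \forall n \near \oo, (vol haar (A n))^-1 * vol haar (A n) <= 1.
    by apply: nearW => n; have [_ _ A0] := vH.1 n; rewrite mulVf// gt_eqF.
  apply: (limit_strongly_ap hausG lcG haarP vH tb_mu tb_nu c_ge0 ltr01 c_le cphi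
    _ (mapP phi cphi)) => t.
  rewrite [X in X @ \oo --> _](_ : _ = (fun n => ((fine (haar (A n)))^-1)%:C%C *
    restr_convolution mu (A n) nu (oppset (A n)) (fun x => phi (t - x)))).
    exact: ebP (Cc_flip t cphi).
  apply/funext => n; congr (_ * _).
  (* Brings [nu] to the outside, since in (a) the convolution to be formed inside is that of
     [mu]. *)
  apply: (etrans _ (esym (mintegral_swap hausG lcG haarP mu nu (bm_open (oA n))
    (bm_oppset (bm_open (oA n))) (pA n) (precompact_oppset (pA n))
    (Cu_flip t (Cc_Cu cphi))))).
  congr mintegral; apply/funext => u; congr mintegral; apply/funext => s.
  by rewrite opprD addrA addrAC.
have [C C0 c_le'] := oppset_vol_le hausG lcG haarP vH.
have c_le : \forall n \near \oo, (vol haar (A n))^-1 * vol haar (oppset (A n)) <= C.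
  apply: filterS c_le' => n; have [_ _ A0] := vH.1 n.
  by rewrite ler_pdivrMl// [X in _ <= X -> _]mulrC.
(* Here [mu] is already the outer measure, integrated over the twice reflected set, which is
   [A n]. *)
apply: (limit_strongly_ap hausG lcG haarP (mean_vH_opp hausG lcG haarP vH)
  tb_nu tb_mu c_ge0 C0 c_le cphi _ (mapP phi cphi)) => t.
rewrite [X in X @ \oo --> _](_ : _ = (fun n => ((fine (haar (A n)))^-1)%:C%C *
  restr_convolution mu (A n) nu (oppset (A n)) (fun x => phi (t - x)))).
  exact: ebP (Cc_flip t cphi).
have phiE s : (fun u => phi (t - s - u)) = (fun u => phi (t - (s + u))).
  by apply/funext => u; rewrite opprD addrA.
apply/funext => n; rewrite oppsetK /restr_convolution.
by under eq_fun do rewrite phiE.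
Qed.
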